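(* Let $\hat S^{(H)}_{t,T}$ be a linear estimator, not necessarily atemporal (so $H$ may depend on $t$ and $r$), and let $r=r(t)>0$ possibly vary with $t$. Suppose that $\mathbb E[\hat S^{(H)}_{t,T}]\ge0$, that $\mu\prec1$, and that, as $t\to\infty$, $$\frac{\big|\sum_{s\in\mathcal S}b_s\big|+\sum_{s\in\mathcal S}b_s^2+\|H\|_\infty^2+1}{\mathbb V[S_{t,T}-\hat S^{(H)}_{t,T}]}\to0.$$ Then, as $t\to\infty$, $$\frac{S_{t,T}-\hat S^{(H)}_{t,T}-\mathbb E[S_{t,T}-\hat S^{(H)}_{t,T}]}{\sqrt{\hat V_t}}\ \overset{d}{\longrightarrow}\ \mathcal N(0,1),\qquad\text{where}\quad \hat V_t:=\hat S^{(H)}_{t,T}+\sum_{s\in\mathcal S}H(N_s)^2.$$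
   Context: Setting (Poissonized unseen species problem). $\mathcal{S}$ is an at most countable set of species and $\mu$ is a probability measure on $2^{\mathcal S}$ supported on finite sets (the empty set may carry mass); $\mu\prec 1$ means $\mu(A)=0$ whenever $|A|>1$. $t,t'>0$, $r=t'/t$, $T=t+t'=(1+r)t$. Let $X_1,X_2,\dots$ be i.i.d. from $\mu$, and let $n\sim\mathrm{Poisson}(t)$, $m\sim\mathrm{Poisson}(t')$ be independent of each other and of the $X_i$. The first expedition observes $X_1,\dots,X_n$, the second $X_{n+1},\dots,X_{n+m}$. For $s\in\mathcal S$, $N_s$ (resp. $N_s'$) is the number of sets observed in the first (resp. second) expedition that contain $s$. $S_t=|\{s:N_s>0\}|$, $S_T=|\{s:N_s+N_s'>0\}|$, $S_{t,T}=S_T-S_t$. A linear estimator is one of the form $\hat S^{(H)}_{t,T}=\sum_{s\in\mathcal S}H(N_s)$ for a function $H:\mathbb Z_{\ge0}\to\mathbb R$ with $H(0)=0$. $\|H\|_\infty=\sup_i|H(i)|$. The bias associated with species $s$ is $b_s=\mathbb E[1_{N_s=0}1_{N_s'>0}-H(N_s)]$. $\mathbb V$ denotes variance. The measure $\mu$ is fixed while $t\to\infty$. When $\hat V_t\le0$ the ratio is assigned an arbitrary fixed value (the choice is immaterial). *)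

(* Defs.v *)
From HB Require Import structures.
From mathcomp Require Export all_boot all_order all_algebra finmap.
From mathcomp Require Export all_classical all_reals all_analysis.
Set Implicit Arguments.
Unset Strict Implicit.
Unset Printing Implicit Defensive.
Export Order.TTheory GRing.Theory Num.Theory.
Export numFieldNormedType.Exports.

Local Open Scope fset_scope.
Local Open Scope classical_set_scope.
Local Open Scope ring_scope.

(* A probability measure on 2^S carried by the finite sets is encoded as a
   probability measure on the countable type {fset S} with its discrete
   sigma-algebra. *)
Section fset_measurable.
Variable S : countType.

HB.instance Definition _ := @isMeasurable.Build default_measure_display
  {fset S} (@discrete_measurable {fset S}) (@discrete_measurable0 _)
  (@discrete_measurableC _) (@discrete_measurableU _).

End fset_measurable.

(* Written mu \prec 1. *)
Definition at_most_one_species (R : realType) (S : countType)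
    (mu : probability {fset S} R) : Prop :=
  forall A : {fset S}, (1 < #|` A|)%N -> mu [set A] = 0%E.

(* [ps_indep] with [A i = setT], [B = setT] or [C = setT] for the indices left
   out is the product rule over every finite subfamily, hence mutual
   independence of X_0, X_1, ..., n, m. *)
Record poisson_sampling (R : realType) (S : countType)
    (mu : probability {fset S} R) (t t' : R)
    (d : measure_display) (Omega : measurableType d) (P : probability Omega R)
    (X : nat -> {RV P >-> {fset S}}) (n m : {RV P >-> nat}) : Prop := {
  ps_law_X : forall (i : nat) (A : set {fset S}), distribution P (X i) A = mu A ;
  ps_law_n : forall k : nat, distribution P n [set k] = (poisson_pmf t k)%:E ;
  ps_law_m : forall k : nat, distribution P m [set k] = (poisson_pmf t' k)%:E ;
  ps_indep : forall (k : nat) (A : nat -> set {fset S}) (B C : set nat),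
    P ((\bigcap_(i in `I_k) X i @^-1` A i) `&` (n @^-1` B `&` m @^-1` C)) =
    ((\prod_(i < k) P (X i @^-1` A i)) * (P (n @^-1` B) * P (m @^-1` C)))%E
}.

(* The sample is indexed from 0: the first expedition observes X_i for
   i < n, the second for n <= i < n + m. *)
Section observations.
Variables (S : countType) (Omega : Type).
Variables (X : nat -> Omega -> {fset S}) (n m : Omega -> nat).

Definition first_count (s : S) (w : Omega) : nat :=
  (\sum_(0 <= i < n w) (s \in X i w))%N.

Definition second_count (s : S) (w : Omega) : nat :=
  (\sum_(n w <= i < n w + m w) (s \in X i w))%N.

(* [fset_set] and the sums over [[set: S]] below are meaningful because only
   finitely many species are observed. *)
Definition seen_first (w : Omega) : nat :=
  #|` fset_set [set s | (0 < first_count s w)%N] |.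

Definition seen_total (w : Omega) : nat :=
  #|` fset_set [set s | (0 < first_count s w + second_count s w)%N] |.

Definition newly_seen (R : realType) (w : Omega) : R :=
  (seen_total w)%:R - (seen_first w)%:R.

Definition linear_estimator (R : realType) (H : nat -> R) (w : Omega) : R :=
  \sum_(s \in [set: S]) H (first_count s w).

Definition prediction_error (R : realType) (H : nat -> R) (w : Omega) : R :=
  newly_seen R w - linear_estimator H w.

Definition variance_estimator (R : realType) (H : nat -> R) (w : Omega) : R :=
  linear_estimator H w + \sum_(s \in [set: S]) H (first_count s w) ^+ 2.

End observations.

Definition sup_norm (R : realType) (H : nat -> R) : \bar R :=
  ereal_sup (range (fun i : nat => `|H i|%:E)).

(* Order-free sum of a summable signed family. *)
Definition signed_esum (R : realType) (S : countType) (f : S -> \bar R) :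
  \bar R := (\esum_(s in [set: S]) f^\+ s - \esum_(s in [set: S]) f^\- s)%E.

Section estimator.
Variables (R : realType) (S : countType).
Variables (d : measure_display) (Omega : measurableType d).
Variable P : probability Omega R.
Variables (X : nat -> {RV P >-> {fset S}}) (n m : {RV P >-> nat}).
Variable H : nat -> R.

Definition species_bias (s : S) : \bar R :=
  'E_P[fun w : Omega =>
    (((first_count X n s w == 0)%N && (0 < second_count X n m s w)%N)%:R
     - H (first_count X n s w))%R]%E.

(* Extended-real quotient: since the numerator is at least 1, it is +oo when
   the variance is 0. As +oo / +oo = 0 for [inve], "the ratio tends to 0" must
   come with [sup_norm H < +oo], which also makes the variance finite. *)
Definition clt_ratio : \bar R :=
  ((`| signed_esum species_bias | + \esum_(s in [set: S]) species_bias s ^+ 2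
     + sup_norm H ^+ 2 + 1)
   / variance P (prediction_error X n m H))%E.

(* [c] is the value assigned when the variance estimator is nonpositive. *)
Definition studentized_error (c : R) (w : Omega) : R :=
  if 0 < variance_estimator X n H w then
    (prediction_error X n m H w - fine 'E_P[prediction_error X n m H])
      / Num.sqrt (variance_estimator X n H w)
  else c.

End estimator.

(* Convergence of the distribution functions at every continuity point of the
   limiting distribution function, each Z_t living on its own space. *)
Definition cvg_in_distribution (R : realType) (d : measure_display)
    (Omega : R -> measurableType d) (P : forall t, probability (Omega t) R)
    (Z : forall t, Omega t -> R) (nu : probability (measurableTypeR R) R)
    : Prop :=
  forall x : R, {for x, continuous (fun y : R => nu `]-oo, y]%classic)} ->
    P t (Z t @^-1` `]-oo, x]%classic) @[t --> +oo] --> nu `]-oo, x]%classic.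

(* Main.v *)
From HB Require Import structures.
Require Import Defs.
From mathcomp Require Import measurable_realfun ring lra.

(** Why the theorem holds.

    When no observed set has two elements, a draw is either empty or one
    species, so the n first and m last draws form two multinomial samples.
    Averaging a multinomial law over a Poisson sample size turns it into a
    product of Poisson laws ([poisson_mixture_weight], [counts_law]): the pairs
    of counts (N_s, N'_s) are independent over s.  Hence the prediction error
    is a sum of independent terms Z_s = 1_{N_s = 0 < N'_s} - H(N_s), each
    bounded by 1 + h where h is the supremum norm of H, while its variance V
    dominates h^2 + 1.

    Normality of a sum of independent terms that are small against its standard
    deviation sigma is proved with Stein's method.  For a continuous compactly
    supported k with Gaussian mean 0, the equation f' - x f = k has a compactly
    supported solution ([stein_equation]), so f' is uniformly continuous and the
    leave-one-out expansion ([finite_stein]) bounds the mean of k(W) by twice the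
    oscillation of f' at scale (maximal term) / sigma.  The sum over all species
    has finitely many nonzero terms and is almost surely dominated by a multiple
    of n + m, which lets the bound pass to the limit ([series_stein_bound]).
    Sandwiching a half-line between continuous functions and using the unit second
    moment for tightness gives the distribution function ([stein_cdf]).

    The estimated variance is unbiased up to the squared biases because H(0) = 0
    makes the cross term of Z_s^2 vanish: Z_s^2 = Z_s + H(N_s) + H(N_s)^2.
    Taking means and summing, V = B + E[Vhat] - sum_s b_s^2 with B = sum_s b_s,
    so the hypothesis on the ratio forces E[Vhat] / V -> 1.  Moreover
    Var(Vhat) <= sum_s E[(H + H^2)^2] <= (1 + h)^2 sum_s E[H^2], and the last sum
    is at most E[Vhat] because the estimator has nonnegative mean.  As (1 + h)^2
    is negligible against V, Chebyshev's inequality makes Vhat / V close to 1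
    with high probability ([variance_estimator_close]), so sigma may be replaced
    by the square root of Vhat at the cost of moving the threshold x by a small
    multiple of |x| ([studentized_cdf]).

    Every estimate holds at a fixed time and depends on the model only through a
    bound on the ratio ([studentized_error_cdf_near]), so neither the change of
    probability space with t nor the dependence of r and H on t matters. *)

Set Implicit Arguments.
Unset Strict Implicit.
Unset Printing Implicit Defensive.
Local Open Scope classical_set_scope.
Local Open Scope ring_scope.

(** * Integration on a probability space *)

Section probability_toolbox.
Context d (T : measurableType d) (R : realType) (P : probability T R).
Implicit Types (f g : T -> R).
Local Notation pr A := (fine (P A)).

Lemma bounded_integrable f M : measurable_fun setT f ->
  (forall w, `|f w| <= M) -> P.-integrable setT (EFin \o f).
Proof.
move=> mf fM; apply: (@le_integrable _ _ _ P setT _ _ (EFin \o cst M)) => //.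
- exact/measurable_EFinP.
- by move=> w _ /=; rewrite lee_fin (le_trans (fM w))// ler_norm.
- by apply: finite_measure_integrable_cst.
Qed.

Lemma integrable_addr f g :
  P.-integrable setT (EFin \o f) -> P.-integrable setT (EFin \o g) ->
  P.-integrable setT (EFin \o (fun w => f w + g w)).
Proof.
move=> fi gi; apply: (eq_integrable measurableT ((EFin \o f) \+ (EFin \o g))%E) => //.
exact: integrableD.
Qed.

Lemma integrable_subr f g :
  P.-integrable setT (EFin \o f) -> P.-integrable setT (EFin \o g) ->
  P.-integrable setT (EFin \o (fun w => f w - g w)).
Proof.
move=> fi gi; apply: (eq_integrable measurableT ((EFin \o f) \- (EFin \o g))%E) => //.
exact: integrableB.
Qed.

Lemma integrable_mulr (k : R) f :
  P.-integrable setT (EFin \o f) -> P.-integrable setT (EFin \o (fun w => k * f w)).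
Proof.
move=> fi; apply: (eq_integrable measurableT (fun w => k%:E * (EFin \o f) w)%E) => //.
exact: integrableZl.
Qed.

Lemma Rintegral_cst1 (c : R) : \int[P]_w c = c.
Proof.
by rewrite Rintegral_cst//= [X in fine X](@probability_setT _ _ _ P)/= mulr1.
Qed.

Lemma norm_Rintegral_le f M : measurable_fun setT f ->
  (forall w, `|f w| <= M) -> `|\int[P]_w f w| <= M.
Proof.
move=> mf fM; have fi := bounded_integrable mf fM.
rewrite (le_trans (le_normr_Rintegral _ _))//.
rewrite (le_trans (le_Rintegral _ _ (f2 := cst M) _ _))//.
- apply: (@bounded_integrable _ M); first exact: measurableT_comp.
  by move=> w; rewrite normr_id.
- exact: (@bounded_integrable _ `|M|).
- by rewrite Rintegral_cst1.
Qed.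

Lemma Rintegral_dominated_cvg (f_ : nat -> T -> R) f g :
  (forall n, measurable_fun setT (f_ n)) ->
  (forall w, f_ n w @[n --> \oo] --> f w) ->
  P.-integrable setT (EFin \o g) ->
  {ae P, forall w, forall n, `|f_ n w| <= g w} ->
  [/\ measurable_fun setT f, P.-integrable setT (EFin \o f) &
      \int[P]_w f_ n w @[n --> \oo] --> \int[P]_w f w].
Proof.
move=> mf_ f_f ig fg.
have mf : measurable_fun setT f.
  by apply: (measurable_fun_cvg mf_) => w _; exact: f_f.
have [|||//||fi _ cv] := @dominated_convergence _ _ _ P setT measurableT
    (fun n w => (f_ n w)%:E) (fun w => (f w)%:E) (EFin \o g).
- by move=> n; exact/measurable_EFinP.
- exact/measurable_EFinP.
- by apply: aeW => w _; apply: cvg_EFin; [near=> n|exact: f_f].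
- by move: fg; apply: filterS => w fgw n _; rewrite lee_fin.
split => //; rewrite /Rintegral; apply: fine_cvg; rewrite fineK//.
exact: integrable_fin_num.
Unshelve. all: by end_near. Qed.

Lemma Rintegral_centered_sqr (Z : T -> R) M : measurable_fun setT Z ->
  (forall w, `|Z w| <= M) ->
  \int[P]_w (Z w - \int[P]_w Z w) ^+ 2 = \int[P]_w Z w ^+ 2 - (\int[P]_w Z w) ^+ 2.
Proof.
move=> mZ bZ; set c := \int[P]_w Z w.
have iZ := bounded_integrable mZ bZ.
have iZ2 : P.-integrable setT (EFin \o (fun w => Z w ^+ 2)).
  apply: (@bounded_integrable _ (M ^+ 2)); first exact: measurable_funX.
  by move=> w; rewrite normrX lerXn2r// nnegrE (le_trans _ (bZ w)).
have ic : P.-integrable setT (EFin \o (fun=> c ^+ 2 : R)) by exact: finite_measure_integrable_cst.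
have icZ := integrable_mulr (2 * c) iZ.
transitivity (\int[P]_w (Z w ^+ 2 - 2 * c * Z w + c ^+ 2)).
  by apply: eq_Rintegral => w _; ring.
rewrite RintegralD//; last exact: integrable_subr.
by rewrite RintegralB// RintegralZl// Rintegral_cst1 -/c; ring.
Qed.

Lemma measurable_superlevel (g : T -> R) (a : R) : measurable_fun setT g ->
  measurable [set w | a <= g w].
Proof.
move=> mg; rewrite (_ : [set _ | _] = g @^-1` `[a, +oo[).
  by rewrite -[X in measurable X]setTI; exact: mg.
by apply/seteqP; split => w /=; rewrite in_itv/= andbT.
Qed.

Lemma fine_measureU (A B : set T) : measurable A -> measurable B ->
  A `&` B = set0 -> fine (P (A `|` B)) = fine (P A) + fine (P B).
Proof. by move=> mA mB AB; rewrite measureU// fineD// fin_num_measure. Qed.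

Lemma fine_measure_le (A B : set T) : measurable A -> measurable B -> A `<=` B ->
  pr A <= pr B.
Proof.
by move=> mA mB AB; apply: fine_le; rewrite ?fin_num_measure// le_measure// inE.
Qed.

Lemma fine_measure_leU (A B C : set T) : measurable A -> measurable B -> measurable C ->
  A `<=` B `|` C -> pr A <= pr B + pr C.
Proof.
move=> mA mB mC AB; rewrite -fineD ?fin_num_measure//; apply: fine_le.
- exact: fin_num_measure.
- by rewrite fin_numD !fin_num_measure.
apply: (@le_trans _ _ (P (B `|` C))).
  by apply: le_measure => //; rewrite inE//; exact: measurableU.
exact: measureU2.
Qed.

Lemma cvg_fine_measure_exhaustion (F : (set T)^nat) :
  (forall n, measurable (F n)) -> nondecreasing_seq F -> \bigcup_n F n = setT ->
  fine (P (F n)) @[n --> \oo] --> (1 : R).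
Proof.
move=> mF ndF UF.
have : (P \o F) n @[n --> \oo] --> 1%:E.
  rewrite -(@probability_setT _ _ _ P) -UF; apply: nondecreasing_cvg_mu => //.
  exact: bigcup_measurable.
by move/fine_cvgP => [].
Qed.

Lemma markov_fine (g : T -> R) (a : R) : measurable_fun setT g ->
  P.-integrable setT (EFin \o g) -> (forall w, 0 <= g w) -> 0 < a ->
  pr [set w | a <= g w] <= (\int[P]_w g w) / a.
Proof.
move=> mg ig g0 a0; pose A := [set w | a <= g w].
have mA : measurable A by exact: measurable_superlevel.
have -> : pr A = \int[P]_w \1_A w by rewrite /Rintegral integral_indic// setIT.
rewrite mulrC -RintegralZl//; apply: le_Rintegral => //.
- apply: (@bounded_integrable _ 1) => // w.
  by rewrite ger0_norm// indicE lern1 leq_b1.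
- exact: integrable_mulr.
move=> w _; rewrite indicE; case: (boolP (w \in A)) => [|_].
  by rewrite inE /A/= => aw; rewrite mulrC ler_pdivlMr// mul1r.
by rewrite mulr_ge0// invr_ge0 ltW.
Qed.

End probability_toolbox.

(** * Stein's equation with compactly supported data *)

Lemma is_derive_continuous (R : realType) (f g : R -> R) :
  (forall x : R, is_derive x 1 f (g x)) -> continuous f.
Proof.
move=> df x; apply: differentiable_continuous.
by apply/derivable1_diffP; case: (df x).
Qed.

Section uniform_continuity.
Context {R : realType}.
Implicit Types (f g h : R -> R) (L : R).

(** On [-L, L] the modulus is uniform by the near-covering form of compactness,
    which chooses one radius for all points at once; two points that are both
    outside give the value 0 twice. *)
Lemma compact_support_unif_continuous g L eps :
  continuous g -> (forall x, L <= `|x| -> g x = 0) -> 0 < eps ->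
  exists2 delta, 0 < delta &
    forall x y, `|x - y| <= delta -> `|g x - g y| <= eps.
Proof.
move=> cg g0 eps0.
have near_cov := (compact_near_coveringP `[- L, L]%classic).1
  (@segment_compact R (- L) L).
pose Q (e x : R) := forall y, `|x - y| <= e -> `|g x - g y| <= eps.
have : \forall e \near 0^'+, `[- L, L]%classic `<=` Q e.
  apply: near_cov => x _; rewrite /Q.
  have /cvgrPdist_le /(_ (eps / 2)) : g y @[y --> x] --> g x by exact: cg.
  rewrite divr_gt0// => /(_ isT) /nbhs_ballP[r /= r0 gr].
  exists ([set x' | `|x - x'| < r / 2], [set e : R | e < r / 2]) => /=.
    split; first by apply/nbhs_ballP; exists (r / 2) => //=; rewrite divr_gt0.
    by apply: nbhs_right_lt; rewrite divr_gt0.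
  move=> [x' e] /= [xx' er] y x'y.
  have rw : g x' - g y = (g x - g y) - (g x - g x') by lra.
  have A1 : `|g x - g x'| <= eps / 2.
    apply: gr; rewrite /ball/=; lra.
  have A2 : `|g x - g y| <= eps / 2.
    apply: gr; rewrite /ball/=.
    have -> : x - y = (x - x') + (x' - y) by lra.
    rewrite (le_lt_trans (ler_normD _ _))//; lra.
  rewrite rw (le_trans (ler_normB _ _))//; lra.
move=> H; near (0 : R)^'+ => d.
have d0 : 0 < d by near: d; exact: nbhs_right_gt.
have HQ : `[- L, L]%classic `<=` Q d by near: d.
exists d => // x y xy.
have [xL|xL] := leP `|x| L.
  apply: (HQ x) => //=; rewrite in_itv/= -ler_norml//.
have [yL|yL] := leP `|y| L.
  rewrite distrC; apply: (HQ y) => //=; first by rewrite in_itv/= -ler_norml.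
  by rewrite distrC.
by rewrite !g0 ?subrr ?normr0 ltW.
Unshelve. all: by end_near. Qed.

Lemma compact_support_bounded f L : continuous f ->
  (forall x, L <= `|x| -> f x = 0) -> exists M, forall x, `|f x| <= M.
Proof.
move=> cf fL; have [L0|L0] := leP 0 L; last first.
  by exists 0 => x; rewrite fL ?normr0// (le_trans (ltW L0)).
have [||x _ fx] := @EVT_max R (fun x => `|f x|) (- L) L.
- by lra.
- by apply: continuous_subspaceT => x; apply: cvg_norm; exact: cf.
exists `|f x| => y; have [yL|/ltW yL] := leP `|y| L.
  by apply: fx; rewrite in_itv/= -ler_norml.
by rewrite (fL _ yL) normr0.
Qed.

End uniform_continuity.

Section stein_equation.
Context {R : realType}.
Implicit Types (h : R -> R) (L : R).
Local Notation mu := (@lebesgue_measure R).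

Definition gauss_integral h := \int[mu]_x (h x * normal_pdf 0 1 x).

Lemma integrable_gauss_bounded h M : measurable_fun setT h ->
  (forall x, `|h x| <= M) ->
  mu.-integrable setT (EFin \o (fun x => h x * normal_pdf 0 1 x)).
Proof.
move=> mh hM.
apply: (@le_integrable _ _ _ mu setT _ _
  (EFin \o (fun x => M * normal_pdf 0 1 x))) => //.
- apply/measurable_EFinP; apply: measurable_funM => //.
  exact: measurable_normal_pdf.
- move=> x _ /=; rewrite lee_fin !normrM.
  by rewrite ler_wpM2r ?(le_trans (hM x))// ler_norm.
- have := @integrableZl _ _ _ mu setT measurableT M _
    (@integrable_normal_pdf R 0 1).
  by apply: eq_integrable => // x _; rewrite /= EFinM.
Qed.

(** With phi the Gaussian density, f = G / phi solves the equation when G is the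
    primitive of h phi vanishing at -oo.  Left of the support of h, G is 0; right
    of it, G is the full integral of h phi, which is 0 by centering.  So f itself
    has compact support, and no estimate of Gaussian tails is needed. *)
Lemma stein_equation h L : continuous h -> 0 < L ->
  (forall x, L <= `|x| -> h x = 0) -> gauss_integral h = 0 ->
  exists f g : R -> R,
    [/\ forall x : R, is_derive x 1 f (g x), continuous g,
        forall x, L < `|x| -> f x = 0 /\ g x = 0
      & forall x, g x - x * f x = h x].
Proof.
move=> ch L0 hL h0.
have mh : measurable_fun setT h by exact: continuous_measurable_fun.
have [M hM] := compact_support_bounded ch hL.
pose k (x : R) := h x * normal_pdf 0 1 x.
have ik : mu.-integrable setT (EFin \o k) by exact: (integrable_gauss_bounded mh hM).
have ck : continuous k.
  by move=> x; apply: cvgM; [exact: ch|apply: continuous_normal_pdf; exact: oner_neq0].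
pose G (x : R) := \int[mu]_(t in [set` Interval -oo%O (BRight x)]) k t.
(* E is 1 / phi, written so that its derivative can be computed. *)
pose c : R := (normal_peak 1)^-1.
pose E (x : R) := c * expR (x ^+ 2 / 2).
have pE x : normal_pdf 0 1 x * E x = 1.
  rewrite normal_pdfE ?oner_neq0// /E /c /normal_fun subr0.
  rewrite expr1n mulNr expRN.
  have p0 : normal_peak (1 : R) != 0 by rewrite gt_eqF// normal_peak_gt0// oner_neq0.
  have e0 : expR (x ^+ 2 / 2) != 0 by rewrite gt_eqF// expR_gt0.
  by rewrite -[1 *+ 2]/(2 : R); field; rewrite p0 e0.
have dG (x : R) : is_derive x 1 G (k x).
  have xx1 : x < x + 1 by rewrite ltrDl.
  have ik1 : mu.-integrable [set` Interval -oo%O (BRight (x + 1))] (EFin \o k).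
    exact: integrableS ik.
  have [Gd Gk] : derivable G x 1 /\ (G^`())%classic x = k x.
    apply: (@continuous_FTC1 R k -oo%O x (x + 1) _ _ _ _) => //=.
    - exact: ltNyr.
    - exact: ck.
  by apply: DeriveDef; [exact: Gd|rewrite -derive1E].
have dE (x : R) : is_derive x 1 E (x * E x).
  have d1 : is_derive x (1 : R) (fun y : R => y ^+ 2 / 2) x.
    have -> : (fun y : R => y ^+ 2 / 2) = (id : R -> R) ^+ 2 * cst 2^-1.
      by apply/funext => y.
    by apply: is_derive_eq; rewrite /GRing.scale/=; field.
  have -> : E = cst c * (expR \o (fun y : R => y ^+ 2 / 2)) by apply/funext => y.
  apply: is_derive_eq; rewrite /GRing.scale/=.
  by rewrite !fctE/=; ring.
pose f x := G x * E x.
have df (x : R) : is_derive x 1 f (h x + x * f x).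
  have -> : f = G * E by apply/funext => y.
  apply: is_derive_eq; rewrite !fctE /k /GRing.scale/=.
  have := pE x; move: (normal_pdf 0 1 x) => p pE1.
  rewrite -[h x in RHS]mulr1 -pE1; ring.
have G0 x : L < `|x| -> G x = 0.
  have int0 (A : set R) : (forall t, A t -> L <= `|t|) -> \int[mu]_(t in A) k t = 0.
    move=> At; rewrite /Rintegral integral0_eq// => t /At Lt.
    by rewrite /k hL// mul0r.
  rewrite lter_normr => /orP[xL|xL].
    have := @Rintegral_itvB R k -oo%O +oo%O x.
    rewrite set_itvNyy => /(_ ik isT isT).
    rewrite [X in X - _](_ : _ = 0); last by rewrite -[RHS]h0.
    rewrite sub0r -/(G x) => /eqP; rewrite eqr_oppLR => /eqP ->.
    rewrite int0 ?oppr0// => t /=; rewrite in_itv/= andbT => xt.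
    by rewrite (le_trans (ltW xL))// (le_trans (ltW xt))// ler_norm.
  apply: int0 => t /=; rewrite in_itv/= => tx.
  by rewrite (le_trans (ltW xL))// -normrN (le_trans _ (ler_norm _))// lerN2.
exists f, (fun x => h x + x * f x); split => //.
- move=> x; apply: cvgD; first exact: ch.
  apply: cvgM; first exact: cvg_id.
  by apply: differentiable_continuous; apply/derivable1_diffP; case: (df x).
- move=> x Lx; have fx : f x = 0 by rewrite /f G0// mul0r.
  by rewrite fx mulr0 addr0 hL// ltW.
- by move=> x; rewrite addrK.
Qed.

End stein_equation.

(** * The Gaussian distribution function *)

Section gauss_cdf.
Context {R : realType}.
Local Notation mu := (@lebesgue_measure R).
Implicit Types (h : R -> R) (x : R).

Definition gauss_cdf x : R := fine (normal_prob 0 1 `]-oo, x]%classic).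

Lemma gauss_integral_le h1 h2 M : measurable_fun setT h1 -> measurable_fun setT h2 ->
  (forall x, `|h1 x| <= M) -> (forall x, `|h2 x| <= M) ->
  (forall x, h1 x <= h2 x) -> gauss_integral h1 <= gauss_integral h2.
Proof.
move=> m1 m2 b1 b2 h12; apply: le_Rintegral => //.
- exact: integrable_gauss_bounded b1.
- exact: integrable_gauss_bounded b2.
- by move=> x _; rewrite ler_wpM2r// normal_pdf_ge0.
Qed.

Lemma gauss_integral_indic (A : set R) : measurable A ->
  gauss_integral \1_A = fine (normal_prob 0 1 A).
Proof.
move=> mA; rewrite /gauss_integral /normal_prob [in RHS]integral_mkcond.
congr fine; apply: eq_integral => x _; rewrite patchE indicE.
by case: ifPn => xA; rewrite ?mul1r ?mul0r.
Qed.

Lemma gauss_integral_setT : gauss_integral (\1_setT : R -> R) = 1.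
Proof.
rewrite gauss_integral_indic//.
by rewrite (@probability_setT _ _ _ (normal_prob 0 1)).
Qed.

(** The density never exceeds its peak. *)
Lemma gauss_cdf_lipschitz x y : x <= y ->
  gauss_cdf x <= gauss_cdf y <= gauss_cdf x + normal_peak 1 * (y - x).
Proof.
move=> xy; rewrite /gauss_cdf.
have -> : `]-oo, y]%classic = `]-oo, x]%classic `|` `]x, y]%classic.
  by rewrite -itv_bndbnd_setU// bnd_simp.
have disj : `]-oo, x]%classic `&` `]x, y]%classic = set0.
  apply/seteqP; split => z //=; rewrite !in_itv/= => -[zx /andP[xz _]].
  by move: (lt_le_trans xz zx); rewrite ltxx.
rewrite (@fine_measureU _ _ _ (normal_prob 0 1))//; apply/andP; split.
  by rewrite lerDl fine_ge0.
rewrite lerD2l.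
have p0 : 0 <= normal_peak (1 : R) by exact: normal_peak_ge0.
have : (normal_prob 0 1 `]x, y]%classic <= (normal_peak 1 * (y - x))%:E)%E.
  rewrite /normal_prob.
  apply: (@le_trans _ _ (\int[mu]_(z in `]x, y]) (normal_peak 1)%:E)%E).
    apply: ge0_le_integral => //.
    - by move=> z _; rewrite lee_fin normal_pdf_ge0.
    - by apply/measurable_EFinP; apply: measurable_funTS; exact: measurable_normal_pdf.
    - by move=> z _; rewrite lee_fin normal_pdf_ub// oner_neq0.
  rewrite integral_cst//= lebesgue_measure_itv/= lte_fin.
  case: ifPn => [_|]; first by rewrite -EFinD.
  by rewrite -leNgt => yx; rewrite mule0 lee_fin mulr_ge0// subr_ge0.
by move=> /fine_le; apply; rewrite ?fin_num_measure.
Qed.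

Lemma gauss_tail eps : 0 < eps ->
  exists2 A0 : R, 0 < A0 & forall A, A0 <= A -> 1 - eps <= gauss_integral \1_`[- A, A].
Proof.
move=> eps0.
pose F (n : nat) : set R := `[- n%:R, n%:R]%classic.
have UF : \bigcup_n F n = setT.
  apply/seteqP; split => // x _; exists (Num.truncn `|x|).+1 => //.
  by rewrite /F/= in_itv/= -ler_norml ltW// truncnS_gt.
have ndF : nondecreasing_seq F.
  move=> m n mn; apply/subsetPset => x; rewrite /F/= !in_itv/= -!ler_norml.
  by move=> /le_trans; apply; rewrite ler_nat.
have mF n : measurable (F n) by exact: measurable_itv.
have /cvgrPdist_le /(_ _ eps0) [n _ Hn] :=
  @cvg_fine_measure_exhaustion _ _ _ (normal_prob 0 1) F mF ndF UF.
exists n.+1%:R => // A nA.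
have := Hn n.+1 (leqnSn n); rewrite /= -gauss_integral_indic; last exact: measurable_itv.
rewrite ler_distlC => /andP[+ _]; move=> /le_trans; apply.
apply: (@gauss_integral_le _ _ 1) => //; try exact: measurable_indic.
- by move=> x; rewrite ger0_norm// indicE lern1 leq_b1.
- by move=> x; rewrite ger0_norm// indicE lern1 leq_b1.
move=> x; rewrite !indicE ler_nat.
case: (boolP (x \in F n.+1)) => //; rewrite /F !inE/= !in_itv/= -!ler_norml => xn.
by rewrite mem_set//= in_itv/= -ler_norml (le_trans xn).
Qed.

(** One cut-off serves both sides of the comparison: it confines the Gaussian law
    by exhaustion, and a variable with second moment at most 1 by Chebyshev's
    bound A^-2. *)
Lemma gauss_cutoff eps : 0 < eps <= 1 -> exists A : R,
  [/\ 0 < A, A ^- 2 <= eps & 1 - eps <= gauss_integral \1_`[- A, A]].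
Proof.
move=> /andP[e0 e1]; have [A0 A00 gA] := gauss_tail e0.
pose A := Num.max A0 eps^-1.
have A_gt0 : 0 < A by rewrite lt_max A00.
exists A; split => //; last by apply: gA; rewrite le_max lexx.
have Ae : A^-1 <= eps by rewrite -(invrK eps) lef_pV2 ?posrE ?invr_gt0// le_max lexx orbT.
rewrite -exprVn (le_trans (_ : _ <= eps ^+ 2))//.
  by rewrite lerXn2r// nnegrE ltW// invr_gt0.
by rewrite expr2 ler_piMl ?(ltW e0).
Qed.

End gauss_cdf.

(** * Trapezoidal test functions *)

Section plateau.
Context {R : realType}.
Implicit Types (a b e w : R).

Definition ramp w : R := Num.max 0 (Num.min 1 (1 - w)).

(** The trapezoid equal to 1 on [a, b] and 0 outside [a - e, b + e]: for e small, a
    continuous substitute for the indicator of an interval. *)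
Definition plateau a b e w : R := ramp ((w - b) / e) * ramp ((a - w) / e).

Lemma ramp_bounds w : 0 <= ramp w <= 1.
Proof. by rewrite /ramp le_max lexx/= ge_max ler01/= ge_min lexx. Qed.

Lemma ramp_left w : w <= 0 -> ramp w = 1.
Proof.
by move=> w0; rewrite /ramp min_l ?max_r//; lra.
Qed.

Lemma ramp_right w : 1 <= w -> ramp w = 0.
Proof. by move=> w1; rewrite /ramp max_l// ge_min; apply/orP; right; lra. Qed.

Lemma continuous_ramp : continuous ramp.
Proof.
move=> w; pose f (y : R) : R^o := 1 - y.
have c1 : {for w, continuous f}.
  by apply: cvgB; [exact: cvg_cst|exact: cvg_id].
have c2 : {for w, continuous (cst (1 : R^o) \min f)}.
  by apply: continuous_min => //; exact: cvg_cst.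
have c3 : {for w, continuous (cst (0 : R^o) \max (cst (1 : R^o) \min f))}.
  by apply: continuous_max => //; exact: cvg_cst.
exact: c3.
Qed.

Lemma continuous_plateau a b e : continuous (plateau a b e).
Proof.
move=> w; apply: cvgM.
  apply: (cvg_comp _ ramp); last exact: continuous_ramp.
  by apply: cvgM; [apply: cvgB; [exact: cvg_id|exact: cvg_cst]|exact: cvg_cst].
apply: (cvg_comp _ ramp); last exact: continuous_ramp.
by apply: cvgM; [apply: cvgB; [exact: cvg_cst|exact: cvg_id]|exact: cvg_cst].
Qed.

Lemma plateau_bounds a b e w : 0 <= plateau a b e w <= 1.
Proof.
rewrite /plateau; have /andP[p0 p1] := ramp_bounds ((w - b) / e).
have /andP[q0 q1] := ramp_bounds ((a - w) / e).
by rewrite mulr_ge0//= mulr_ile1.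
Qed.

Lemma plateau1 a b e w : 0 < e -> a <= w <= b -> plateau a b e w = 1.
Proof.
move=> e0 /andP[aw wb]; rewrite /plateau !ramp_left ?mulr1//.
  by rewrite pmulr_lle0 ?invr_gt0// subr_le0.
by rewrite pmulr_lle0 ?invr_gt0// subr_le0.
Qed.

Lemma plateau0r a b e w : 0 < e -> b + e <= w -> plateau a b e w = 0.
Proof.
move=> e0 bw; rewrite /plateau ramp_right ?mul0r//.
by rewrite ler_pdivlMr// mul1r; lra.
Qed.

Lemma plateau0l a b e w : 0 < e -> w <= a - e -> plateau a b e w = 0.
Proof.
move=> e0 bw; rewrite /plateau mulrC ramp_right ?mul0r//.
by rewrite ler_pdivlMr// mul1r; lra.
Qed.

Lemma plateau_support a b e w : 0 < e -> `|a| + `|b| + e <= `|w| ->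
  plateau a b e w = 0.
Proof.
move=> e0; have := ler_norm b; have := ler_norm (- a); rewrite normrN => a1 b1.
have [w0|w0] := leP 0 w.
  by rewrite (ger0_norm w0) => h; apply: plateau0r => //; have := normr_ge0 a; lra.
by rewrite (ltr0_norm w0) => h; apply: plateau0l => //; have := normr_ge0 b; lra.
Qed.

End plateau.

(** * From Stein bounds to the normal distribution function *)

(** What Stein's method yields for W, a sum whose terms are bounded by delta: the
    defect in the Gaussian identity E[W f(W)] = E[f'(W)] is controlled by the
    oscillation of f' at scale delta.  This is the only information on W, besides
    its second moment, that the normal approximation uses, and it makes the
    approximation uniform over all probability spaces. *)
Definition stein_bound d (T : measurableType d) (R : realType)
    (P : probability T R) (W : T -> R) (delta : R) : Prop :=
  forall (f g : R -> R) (M omega : R),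
    (forall x : R, is_derive x 1 f (g x)) -> continuous g ->
    (forall x, [/\ `|f x| <= M, `|x * f x| <= M & `|g x| <= M]) ->
    (forall x y, `|x - y| <= delta -> `|g x - g y| <= omega) ->
  `| \int[P]_w (W w * f (W w)) - \int[P]_w g (W w) | <= 2 * omega.

Section stein_method.
Context {R : realType}.
Implicit Types (h : R -> R) (L : R).

Lemma stein_bound_le d (T : measurableType d) (P : probability T R)
    (W : T -> R) (delta delta' : R) : delta <= delta' ->
  stein_bound P W delta -> stein_bound P W delta'.
Proof.
move=> dd' Wd f g M omega df cg b gomega; apply: (Wd f g M) => // x y xy.
by apply: gomega; exact: le_trans dd'.
Qed.

(** The Stein solution depends on h only, hence so does the scale delta at which
    its derivative oscillates by at most eps / 2. *)
Lemma stein_centered_test h L eps : continuous h -> 0 < L ->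
  (forall x, L <= `|x| -> h x = 0) -> gauss_integral h = 0 -> 0 < eps ->
  exists2 delta, 0 < delta & forall d (T : measurableType d)
    (P : probability T R) (W : T -> R), measurable_fun setT W ->
    stein_bound P W delta -> `|\int[P]_w h (W w)| <= eps.
Proof.
move=> ch L0 hL h0 eps0.
have [f [g [df cg fgL gf]]] := stein_equation ch L0 hL h0.
have cf := is_derive_continuous df.
have cxf : continuous (fun x : R => x * f x).
  by move=> x; apply: cvgM; [exact: cvg_id|exact: cf].
have L1 x : L + 1 <= `|x| -> L < `|x| by move=> ?; lra.
have f0 x : L + 1 <= `|x| -> f x = 0 by move=> /L1/fgL[].
have g0 x : L + 1 <= `|x| -> g x = 0 by move=> /L1/fgL[].
have xf0 x : L + 1 <= `|x| -> x * f x = 0 by move=> /f0 ->; rewrite mulr0.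
have [Mf fM] := compact_support_bounded cf f0.
have [Mg gM] := compact_support_bounded cg g0.
have [Mx xM] := compact_support_bounded cxf xf0.
have [delta delta0 gdelta] : exists2 delta, 0 < delta &
    forall x y, `|x - y| <= delta -> `|g x - g y| <= eps / 2.
  by apply: compact_support_unif_continuous g0 _ => //; rewrite divr_gt0.
exists delta => // d T P W mW /(_ f g (Mf + Mg + Mx) (eps / 2) df cg).
have M0 := (le_trans (normr_ge0 _) (fM 0), le_trans (normr_ge0 _) (gM 0),
  le_trans (normr_ge0 _) (xM 0)).
have b x : [/\ `|f x| <= Mf + Mg + Mx, `|x * f x| <= Mf + Mg + Mx &
    `|g x| <= Mf + Mg + Mx].
  move: (fM x) (gM x) (xM x) M0.1.1 M0.1.2 M0.2 => ? ? ? ? ? ?.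
  by split; lra.
move=> /(_ b gdelta); rewrite mulrC divfK//.
have mcomp (k : R -> R) : continuous k -> measurable_fun setT (k \o W).
  by move=> ck; apply: measurableT_comp => //; exact: continuous_measurable_fun.
rewrite -RintegralB//; last 2 first.
- by apply: (@bounded_integrable _ _ _ _ _ Mx); first exact: (mcomp _ cxf).
- by apply: (@bounded_integrable _ _ _ _ _ Mg); first exact: (mcomp _ cg).
rewrite -normrN; rewrite (_ : - _ = \int[P]_w h (W w))//.
rewrite -mulN1r -RintegralZl//.
  by apply: eq_Rintegral => w _; rewrite -gf; ring.
apply: (@bounded_integrable _ _ _ _ _ (Mx + Mg)).
  by apply: measurable_funB; [exact: (mcomp _ cxf)|exact: (mcomp _ cg)].
by move=> w; rewrite (le_trans (ler_normB _ _))// lerD.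
Qed.

End stein_method.

Section normal_approximation.
Context {R : realType}.
Implicit Types (h : R -> R) (L : R).

Lemma gauss_integral_plateau_le1 a b e : gauss_integral (plateau a b e : R -> R) <= 1.
Proof.
rewrite -[leRHS](@gauss_integral_setT R).
apply: (@gauss_integral_le _ _ _ 1) => //.
- by apply: continuous_measurable_fun; exact: continuous_plateau.
- by move=> x; have /andP[? ?] := plateau_bounds a b e x; rewrite ger0_norm.
- by move=> x; rewrite indicT normr1.
- by move=> x; rewrite indicT; have /andP[] := plateau_bounds a b e x.
Qed.

Lemma gauss_integralD h1 h2 M : measurable_fun setT h1 -> measurable_fun setT h2 ->
  (forall x, `|h1 x| <= M) -> (forall x, `|h2 x| <= M) ->
  gauss_integral (fun x => h1 x + h2 x) = gauss_integral h1 + gauss_integral h2.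
Proof.
move=> m1 m2 b1 b2; rewrite -RintegralD//.
- by apply: eq_Rintegral => x _; rewrite mulrDl.
- exact: integrable_gauss_bounded b1.
- exact: integrable_gauss_bounded b2.
Qed.

Lemma one_le_scaled_sqr (A w : R) : 0 < A -> A <= `|w| -> 1 <= A ^- 2 * w ^+ 2.
Proof.
move=> A0 Aw; rewrite mulrC ler_pdivlMr ?exprn_gt0// mul1r.
by rewrite -(real_normK (num_real w)) lerXn2r// nnegrE ltW.
Qed.

(** A pointwise Chebyshev inequality: integrating it gives tightness in the form of
    a lower bound on the mean of a wide plateau. *)
Lemma one_le_plateauD_sqr (A e w : R) : 0 < A -> 0 < e ->
  1 <= plateau (- A) A e w + A ^- 2 * w ^+ 2.
Proof.
move=> A0 e0; have /andP[p0 p1] := plateau_bounds (- A) A e w.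
have [wA|/ltW Aw] := leP `|w| A.
  rewrite plateau1//; last by rewrite -ler_norml.
  by rewrite lerDl mulr_ge0// ?sqr_ge0// invr_ge0 sqr_ge0.
by rewrite -[leLHS]add0r lerD// one_le_scaled_sqr.
Qed.

Definition unit_second_moment d (T : measurableType d) (P : probability T R)
    (W : T -> R) : Prop :=
  [/\ measurable_fun setT W, P.-integrable setT (EFin \o (fun w => W w ^+ 2))
    & \int[P]_w W w ^+ 2 <= 1].

Section tightness.
Context d (T : measurableType d) (P : probability T R) (W : T -> R).
Hypothesis W2 : unit_second_moment P W.

Lemma integrable_comp_bounded h M : measurable_fun setT h ->
  (forall x, `|h x| <= M) -> P.-integrable setT (EFin \o (h \o W)).
Proof.
move=> mh hM; apply: (@bounded_integrable _ _ _ _ _ M) => [|w]; last exact: hM.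
by apply: measurableT_comp => //; case: W2.
Qed.

Lemma integrable_plateau a b e :
  P.-integrable setT (EFin \o (plateau a b e \o W)).
Proof.
apply: (@integrable_comp_bounded _ 1).
  by apply: continuous_measurable_fun; exact: continuous_plateau.
by move=> x; have /andP[? ?] := plateau_bounds a b e x; rewrite ger0_norm.
Qed.

Lemma second_moment_tail A : 0 < A -> \int[P]_w (A ^- 2 * W w ^+ 2) <= A ^- 2.
Proof.
move=> A0; case: W2 => mW iW EW; rewrite RintegralZl//.
by rewrite ler_piMr// invr_ge0 sqr_ge0.
Qed.

Lemma integrable_second_moment A :
  P.-integrable setT (EFin \o (fun w => A ^- 2 * W w ^+ 2)).
Proof.
case: W2 => mW iW EW.
by have := integrableZl measurableT (A ^- 2) iW; apply: eq_integrable.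
Qed.

Lemma plateau_mean_ge A e : 0 < A -> 0 < e ->
  1 - A ^- 2 <= \int[P]_w plateau (- A) A e (W w) <= 1.
Proof.
move=> A0 e0; apply/andP; split; last first.
  rewrite -[leRHS](Rintegral_cst1 P).
  apply: le_Rintegral => //; first exact: integrable_plateau.
    exact: finite_measure_integrable_cst.
  by move=> w _; have /andP[] := plateau_bounds (- A) A e (W w).
rewrite lerBlDr -[leLHS](Rintegral_cst1 P).
apply: le_trans (lerD (lexx _) (second_moment_tail A0)).
rewrite -RintegralD//; [|exact: integrable_plateau|exact: integrable_second_moment].
apply: le_Rintegral => //; first exact: finite_measure_integrable_cst.
  have := integrableD measurableT (integrable_plateau (- A) A e)
    (integrable_second_moment A).
  by apply: eq_integrable.
by move=> w _; exact: one_le_plateauD_sqr.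
Qed.

End tightness.

(** A test function is centred for the Gaussian law by subtracting a multiple lam
    of a plateau so wide that its mean is almost 1 both for the Gaussian law and
    for W.  Subtracting the constant mean instead would destroy the compact
    support that Stein's equation requires. *)
Lemma stein_test h L eps : continuous h -> (forall x, 0 <= h x <= 1) ->
  (forall x, L <= `|x| -> h x = 0) -> 0 < eps ->
  exists2 delta, 0 < delta & forall d (T : measurableType d)
    (P : probability T R) (W : T -> R), unit_second_moment P W ->
    stein_bound P W delta ->
    `|\int[P]_w h (W w) - gauss_integral h| <= eps.
Proof.
move=> ch h01 hL eps0.
pose e := Num.min (eps / 3) (1 / 2).
have e0 : 0 < e by rewrite /e lt_min !divr_gt0.
have [e3 e2] : e <= eps / 3 /\ e <= 1 / 2 by split; rewrite ge_min lexx ?orbT.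
have [A [A_gt0 A2e gA]] := @gauss_cutoff R e ltac:(lra).
pose k : R -> R := plateau (- A) A 1.
have ck : continuous k by exact: continuous_plateau.
have k01 x : 0 <= k x <= 1 by exact: plateau_bounds.
have nk x : `|k x| <= 1 by have /andP[? ?] := k01 x; rewrite ger0_norm.
have nh x : `|h x| <= 1 by have /andP[? ?] := h01 x; rewrite ger0_norm.
have mk : measurable_fun setT k by exact: continuous_measurable_fun.
have mh : measurable_fun setT h by exact: continuous_measurable_fun.
have gk1 : gauss_integral k <= 1 by exact: gauss_integral_plateau_le1.
have gk0 : 1 - e <= gauss_integral k.
  apply: (le_trans gA).
  apply: (@gauss_integral_le _ _ _ 1) => //.
  - by move=> x; rewrite ger0_norm// indicE lern1 leq_b1.
  - move=> x; rewrite indicE; case: (boolP (x \in _)) => [|_]; last first.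
      by case/andP: (k01 x).
    by rewrite inE/= in_itv/= => xA; rewrite /k plateau1.
(* lam makes h - lam k centred; it is at most 2 since k has mean >= 1/2. *)
pose lam := gauss_integral h / gauss_integral k.
have gk_gt0 : 0 < gauss_integral k by lra.
have gh0 : 0 <= gauss_integral h <= 1.
  have -> : 0 = gauss_integral (cst (0 : R)).
    rewrite /gauss_integral /Rintegral integral0_eq// => x _.
    by rewrite /cst/= mul0r.
  rewrite -[X in _ <= _ <= X](@gauss_integral_setT R).
  apply/andP; split; apply: (@gauss_integral_le _ _ _ 1) => //.
  - by move=> x; rewrite normr0.
  - by move=> x; case/andP: (h01 x).
  - by move=> x; rewrite indicT normr1.
  - by move=> x; rewrite indicT; case/andP: (h01 x).
have lam02 : 0 <= lam <= 2.
  rewrite /lam divr_ge0/=; [|lra|lra].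
  by rewrite ler_pdivrMr//; lra.
have lamE : lam * gauss_integral k = gauss_integral h by rewrite divfK// gt_eqF.
pose h' x := h x - lam * k x.
pose L' := `|L| + A + A + 1.
have L'0 : 0 < L' by rewrite /L'; have := normr_ge0 L; lra.
have ch' : continuous h'.
  move=> x; apply: cvgB; first exact: ch.
  by apply: cvgM; [exact: cvg_cst|exact: ck].
have hL' x : L' <= `|x| -> h' x = 0.
  move=> L'x; rewrite /h' hL; last first.
    by rewrite (le_trans _ L'x)// /L'; have := ler_norm L; lra.
  rewrite /k plateau_support ?mulr0 ?subr0//.
  rewrite normrN (gtr0_norm A_gt0) (le_trans _ L'x)// /L'.
  by have := normr_ge0 L; lra.
have gh' : gauss_integral h' = 0.
  have ih := integrable_gauss_bounded mh nh.
  have ik := integrable_gauss_bounded mk nk.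
  have ilk : (@lebesgue_measure R).-integrable setT
      (EFin \o (fun x => lam * (k x * normal_pdf 0 1 x))).
    by have := integrableZl measurableT lam ik; apply: eq_integrable.
  have -> : gauss_integral h' = \int[lebesgue_measure]_x
      (h x * normal_pdf 0 1 x - lam * (k x * normal_pdf 0 1 x)).
    by apply: eq_Rintegral => x _; rewrite /h'; ring.
  by rewrite RintegralB// RintegralZl// -/(gauss_integral k) lamE subrr.
have [delta delta0 Hd] := stein_centered_test ch' L'0 hL' gh' e0.
exists delta => // d T P W W2 Wd.
have mW : measurable_fun setT W by case: W2.
have {Hd} := Hd d T P W mW Wd.
have ihW := integrable_comp_bounded W2 mh nh.
have ikW := integrable_comp_bounded W2 mk nk.
have ilkW : P.-integrable setT (EFin \o (fun w => lam * k (W w))).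
  by have := integrableZl measurableT lam ikW; apply: eq_integrable.
rewrite RintegralB// RintegralZl//.
have := @plateau_mean_ge _ _ _ _ W2 _ _ A_gt0 (@ltr01 R).
rewrite -/k; move: (\int[P]_w h (W w)) (\int[P]_w k (W w)) => a b /andP[b1 b2] ab.
rewrite -lamE (_ : _ - _ = (a - lam * b) + lam * (b - gauss_integral k)); last by ring.
rewrite (le_trans (ler_normD _ _))//.
have : `|lam * (b - gauss_integral k)| <= 2 * e.
  have /andP[l0 l2] := lam02.
  rewrite normrM (ger0_norm l0) ler_pM//.
  by rewrite ler_norml; apply/andP; split; lra.
by lra.
Qed.

(** The half-line up to x lies, up to the tail below -A, between two trapezoids whose
    slopes have width r.  The slopes cost at most c r for the Gaussian law, c being
    the peak of its density, and the tails at most e on either side. *)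
Lemma stein_cdf x eps : 0 < eps ->
  exists2 delta, 0 < delta & forall d (T : measurableType d)
    (P : probability T R) (W : T -> R), unit_second_moment P W ->
    stein_bound P W delta ->
    `|fine (P (W @^-1` `]-oo, x]%classic)) - gauss_cdf x| <= eps.
Proof.
move=> eps0.
pose c : R := normal_peak 1; have c0 : 0 <= c by exact: normal_peak_ge0.
pose e := Num.min (eps / 4) 1.
have e0 : 0 < e by rewrite /e lt_min !divr_gt0/=.
have [e4 e1] : e <= eps / 4 /\ e <= 1 by split; rewrite ge_min lexx ?orbT.
pose r := e / (c + 1).
have c1 : 0 < c + 1 by lra.
have r0 : 0 < r by rewrite divr_gt0.
have cr : c * r <= e by rewrite /r mulrCA ler_piMr ?(ltW e0)// ler_pdivrMr//; lra.
have [A [A_gt0 A2e gA]] := @gauss_cutoff R e ltac:(lra).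
pose h1 : R -> R := plateau (- A) x r.
pose h2 : R -> R := plateau (- A) (x - r) r.
have [d1 d10 H1] := stein_test (@continuous_plateau _ (- A) x r)
  (plateau_bounds (- A) x r) (fun y => @plateau_support _ (- A) x r y r0) e0.
have [d2 d20 H2] := stein_test (@continuous_plateau _ (- A) (x - r) r)
  (plateau_bounds (- A) (x - r) r)
  (fun y => @plateau_support _ (- A) (x - r) r y r0) e0.
exists (Num.min d1 d2); first by rewrite lt_min d10.
move=> d T P W W2 Wd.
have dd1 : Num.min d1 d2 <= d1 by rewrite ge_min lexx.
have dd2 : Num.min d1 d2 <= d2 by rewrite ge_min lexx orbT.
have {H1} := H1 _ _ _ _ W2 (stein_bound_le dd1 Wd).
have {H2} := H2 _ _ _ _ W2 (stein_bound_le dd2 Wd).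
rewrite -/h1 -/h2.
have mW : measurable_fun setT W by case: W2.
pose Wx := W @^-1` `]-oo, x]%classic.
have mWx : measurable Wx by rewrite -[Wx]setTI; exact: mW.
have iWx : P.-integrable setT (EFin \o (\1_Wx : T -> R)).
  apply: (@bounded_integrable _ _ _ _ _ 1) => // w.
  by rewrite ger0_norm// indicE lern1 leq_b1.
have PE : fine (P Wx) = \int[P]_w \1_Wx w.
  by rewrite /Rintegral integral_indic// setIT.
have up : fine (P Wx) <= \int[P]_w h1 (W w) + A ^- 2.
  rewrite PE; apply: le_trans (lerD (lexx _) (second_moment_tail W2 A_gt0)).
  have i1 := integrable_plateau W2 (- A) x r.
  have i2 := integrable_second_moment W2 A.
  rewrite -RintegralD//; apply: le_Rintegral => //.
    by have := integrableD measurableT i1 i2; apply: eq_integrable.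
  move=> w _; rewrite indicE; case: (boolP (w \in Wx)) => [|_]; last first.
    rewrite addr_ge0//; first by case/andP: (plateau_bounds (- A) x r (W w)).
    by rewrite mulr_ge0 ?sqr_ge0// invr_ge0 sqr_ge0.
  rewrite inE /Wx/= in_itv/= => Wwx.
  have [AW|AW] := leP (- A) (W w).
    rewrite /h1 plateau1// ?AW//.
    by rewrite lerDl mulr_ge0 ?sqr_ge0// invr_ge0 sqr_ge0.
  rewrite -[leLHS]add0r lerD//; first by case/andP: (plateau_bounds (- A) x r (W w)).
  by rewrite one_le_scaled_sqr// -normrN (le_trans _ (ler_norm _))//; lra.
have lo : \int[P]_w h2 (W w) <= fine (P Wx).
  rewrite PE; apply: le_Rintegral => //; first exact: integrable_plateau.
  move=> w _; rewrite indicE; have /andP[p0 p1] := plateau_bounds (- A) (x - r) r (W w).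
  case: (boolP (w \in Wx)) => // Wxw; rewrite /h2 plateau0r//.
  rewrite subrK leNgt; apply: contra Wxw => Wwx.
  by rewrite inE /Wx/= in_itv/= ltW.
have gx : gauss_integral (\1_`]-oo, x] : R -> R) = gauss_cdf x.
  by rewrite gauss_integral_indic.
have n1 (B : set R) z : `|\1_B z : R| <= 1.
  by rewrite ger0_norm// indicE lern1 leq_b1.
have np a b e' y : `|plateau a b e' y : R| <= 1.
  by have /andP[? ?] := plateau_bounds a b e' y; rewrite ger0_norm.
have mp a b e' : measurable_fun setT (plateau a b e' : R -> R).
  by apply: continuous_measurable_fun; exact: continuous_plateau.
have gup : gauss_integral h1 <= gauss_cdf x + e.
  have : gauss_integral h1 <= gauss_cdf (x + r).
    rewrite /gauss_cdf -gauss_integral_indic//.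
    apply: (@gauss_integral_le _ _ _ 1);
      [exact: mp|exact: measurable_indic|exact: np|exact: n1|move=> y].
    rewrite indicE; have /andP[p0 p1] := plateau_bounds (- A) x r y.
    case: (boolP (y \in _)) => // yx; rewrite /h1 plateau0r//.
    rewrite leNgt; apply: contra yx => yx.
    by rewrite inE/= in_itv/= ltW.
  have /andP[_] := @gauss_cdf_lipschitz R x (x + r) ltac:(lra).
  rewrite -/c (_ : x + r - x = r); last by ring.
  by lra.
have glo : gauss_cdf x <= gauss_integral h2 + e + e.
  have : gauss_cdf (x - r) + (1 - e) <= gauss_integral h2 + 1.
    rewrite -[X in _ <= _ + X](@gauss_integral_setT R) /gauss_cdf.
    rewrite -gauss_integral_indic//.
    apply: (@le_trans _ _ (gauss_integral (\1_`]-oo, (x - r)%R] : R -> R) +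
      gauss_integral (\1_`[- A, A] : R -> R))).
      by rewrite lerD2l.
    have mi (B : set R) : measurable B -> measurable_fun setT (\1_B : R -> R).
      by move=> mB; exact: measurable_indic.
    have m1 := mi _ (measurable_itv `]-oo, (x - r)]).
    have m2 := mi _ (measurable_itv `[- A, A]).
    have m3 := mi _ (@measurableT _ (measurableTypeR R)).
    rewrite -(gauss_integralD m1 m2 (n1 _) (n1 _)).
    rewrite -(gauss_integralD (mp _ _ _) m3 (np _ _ _) (n1 _)).
    apply: (@gauss_integral_le _ _ _ 2).
    - exact: measurable_funD.
    - by apply: measurable_funD => //; exact: mp.
    - by move=> y; rewrite (le_trans (ler_normD _ _))// lerD ?n1.
    - by move=> y; rewrite (le_trans (ler_normD _ _))// lerD ?n1 ?np.
    move=> y; rewrite indicT !indicE.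
    have /andP[p0 p1] := plateau_bounds (- A) (x - r) r y.
    case: (boolP (y \in `]-oo, (x - r)%R]%classic)) => [|_]; last first.
      by rewrite add0r (le_trans _ (lerD p0 (lexx _)))// add0r lern1 leq_b1.
    rewrite inE/= in_itv/= => yx.
    case: (boolP (y \in `[- A, A]%classic)) => [|_]; last first.
      by rewrite addr0 lerDr.
    rewrite inE/= in_itv/= => /andP[Ay yA].
    by rewrite /h2 plateau1// Ay.
  have /andP[_] := @gauss_cdf_lipschitz R (x - r) x ltac:(lra).
  rewrite -/c (_ : x - (x - r) = r); last by ring.
  by lra.
by rewrite !ler_norml => /andP[? ?] /andP[? ?]; apply/andP; split; lra.
Qed.

End normal_approximation.

(** * Stein's method for sums with leave-one-out independence *)

Section independent_pair.
Context d (T : measurableType d) (R : realType) (P : probability T R).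
Implicit Types (U V : T -> R).

Definition indep_fun U V : Prop := forall A B : set R, measurable A -> measurable B ->
  P ((U @^-1` A) `&` (V @^-1` B)) = (P (U @^-1` A) * P (V @^-1` B))%E.

Lemma indep_fun_comp U V (f g : R -> R) : measurable_fun setT f ->
  measurable_fun setT g -> indep_fun U V -> indep_fun (f \o U) (g \o V).
Proof.
move=> mf mg UV A B mA mB; apply: (UV (f @^-1` A) (g @^-1` B)).
  by rewrite -[f @^-1` A]setTI; exact: mf.
by rewrite -[g @^-1` B]setTI; exact: mg.
Qed.

(** The law of (U, V) agrees with the product of the marginal laws on rectangles,
    hence everywhere, and Tonelli's theorem factors the integral.  The integrand on
    the plane uses positive parts so that it is nonnegative off the range of (U, V)
    too. *)
Let ge0_integral_indep_fun (U V : {mfun T >-> R}) : (forall w, 0 <= U w) ->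
  (forall w, 0 <= V w) -> indep_fun U V ->
  (\int[P]_w (U w * V w)%:E = (\int[P]_w (U w)%:E) * (\int[P]_w (V w)%:E))%E.
Proof.
move=> U0 V0 UV.
pose UVf w := (U w, V w).
have mUV : measurable_fun setT UVf.
  by apply/measurable_fun_pairP; split; exact: measurable_funPT.
pose UVm : {mfun T >-> (R * R)%type} := HB.pack UVf (isMeasurableFun.Build _ _ _ _ UVf mUV).
pose m1 := distribution P U; pose m2 := distribution P V.
pose pos (x : R) := Num.max x 0.
pose f (z : R * R) := (pos z.1 * pos z.2)%:E.
have mpos : measurable_fun setT pos by apply: measurable_maxr => //; exact: measurable_cst.
have mf : measurable_fun setT f.
  apply/measurable_EFinP; apply: measurable_funM.
    by apply: measurableT_comp => //; exact: measurable_fst.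
  by apply: measurableT_comp => //; exact: measurable_snd.
have pos0 x : 0 <= pos x by rewrite le_max lexx orbT.
have f0 z : (0 <= f z)%E by rewrite lee_fin mulr_ge0.
have posU w : pos (U w) = U w by rewrite /pos max_l.
have posV w : pos (V w) = V w by rewrite /pos max_l.
transitivity (\int[distribution P UVm]_z f z)%E.
  rewrite ge0_integral_distribution//; apply: eq_integral => w _.
  by rewrite /f /= posU posV.
transitivity (\int[m1 \x m2]_z f z)%E.
  apply: eq_measure_integral => A mA _.
  by apply/esym/product_measure_unique => // B C mB mC; exact: UV.
rewrite fubini_tonelli1//.
have intV : (\int[P]_w (V w)%:E = \int[m2]_y (pos y)%:E)%E.
  rewrite ge0_integral_distribution//.
  - by apply: eq_integral => w _ /=; rewrite posV.
  - exact/measurable_EFinP.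
have intU : (\int[P]_w (U w)%:E = \int[m1]_y (pos y)%:E)%E.
  rewrite ge0_integral_distribution//.
  - by apply: eq_integral => w _ /=; rewrite posU.
  - exact/measurable_EFinP.
rewrite intU intV -ge0_integralZr//; last 3 first.
- exact/measurable_EFinP.
- by move=> x _; rewrite lee_fin.
- by apply: integral_ge0 => y _; rewrite lee_fin.
apply: eq_integral => x _; rewrite /fubini_F /f/=.
under eq_integral do rewrite EFinM.
rewrite ge0_integralZl//.
- exact/measurable_EFinP.
- by move=> y _; rewrite lee_fin.
- by rewrite lee_fin.
Qed.

(** Adding M makes both factors nonnegative, and the terms linear in U and V cancel
    out of the expanded product. *)
Lemma Rintegral_indep_fun U V M : measurable_fun setT U -> measurable_fun setT V ->
  (forall w, `|U w| <= M) -> (forall w, `|V w| <= M) -> indep_fun U V ->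
  \int[P]_w (U w * V w) = (\int[P]_w U w) * (\int[P]_w V w).
Proof.
move=> mU mV bU bV UV.
have mU' : measurable_fun setT (fun w => U w + M) by exact: measurable_funD.
have mV' : measurable_fun setT (fun w => V w + M) by exact: measurable_funD.
pose U' : {mfun T >-> R} := HB.pack (fun w => U w + M) (isMeasurableFun.Build _ _ _ _ _ mU').
pose V' : {mfun T >-> R} := HB.pack (fun w => V w + M) (isMeasurableFun.Build _ _ _ _ _ mV').
have U0 w : 0 <= U' w by have := bU w; rewrite ler_norml => /andP[]; rewrite /=; lra.
have V0 w : 0 <= V' w by have := bV w; rewrite ler_norml => /andP[]; rewrite /=; lra.
have M0 (w : T) : 0 <= M by exact: le_trans (normr_ge0 _) (bU w).
have UV' : indep_fun U' V'.
  apply: (@indep_fun_comp U V (fun x => x + M) (fun x => x + M)) => //.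
    exact: measurable_funD.
  exact: measurable_funD.
have iU := bounded_integrable P mU bU.
have iV := bounded_integrable P mV bV.
have ic : P.-integrable setT (EFin \o cst M) by exact: finite_measure_integrable_cst.
have EU : \int[P]_w U' w = \int[P]_w U w + M.
  rewrite /= RintegralD//; congr (_ + _).
  by rewrite Rintegral_cst1.
have EV : \int[P]_w V' w = \int[P]_w V w + M.
  rewrite /= RintegralD//; congr (_ + _).
  by rewrite Rintegral_cst1.
have EUV : \int[P]_w (U' w * V' w) = (\int[P]_w U' w) * (\int[P]_w V' w).
  rewrite /Rintegral ge0_integral_indep_fun// fineM//; apply: integrable_fin_num => //.
    apply: (@bounded_integrable _ _ _ P _ (M + M)) => // w.
    by rewrite (le_trans (ler_normD _ _))// lerD// ger0_norm// M0.
  apply: (@bounded_integrable _ _ _ P _ (M + M)) => // w.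
  by rewrite (le_trans (ler_normD _ _))// lerD// ger0_norm// M0.
have iUV : P.-integrable setT (EFin \o (fun w => U w * V w)).
  apply: (@bounded_integrable _ _ _ P _ (M * M)); first exact: measurable_funM.
  by move=> w; rewrite normrM ler_pM.
have iMU : P.-integrable setT (EFin \o (fun w => M * U w)).
  by have := integrableZl measurableT M iU; apply: eq_integrable.
have iMV : P.-integrable setT (EFin \o (fun w => M * V w)).
  by have := integrableZl measurableT M iV; apply: eq_integrable.
have iMM : P.-integrable setT (EFin \o (fun w => M * M)).
  exact: finite_measure_integrable_cst.
have : \int[P]_w (U' w * V' w) =
    \int[P]_w (U w * V w) + (M * \int[P]_w V w + (M * \int[P]_w U w + M * M)).
  transitivity (\int[P]_w (U w * V w + (M * V w + (M * U w + M * M)))).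
    by apply: eq_Rintegral => w _; rewrite /=; ring.
  have i1 : P.-integrable setT (EFin \o (fun w => M * U w + M * M)).
    by have := integrableD measurableT iMU iMM; apply: eq_integrable.
  have i2 : P.-integrable setT (EFin \o (fun w => M * V w + (M * U w + M * M))).
    by have := integrableD measurableT iMV i1; apply: eq_integrable.
  rewrite RintegralD// RintegralD// RintegralD// !RintegralZl//.
  congr (_ + (_ + (_ + _))).
  by rewrite Rintegral_cst1.
rewrite EUV EU EV; move: (\int[P]_w U w) (\int[P]_w V w) (\int[P]_w (U w * V w)).
by clear => a b e h; lra.
Qed.

End independent_pair.

(** By the mean value theorem the left-hand side is x (g c - g v) with c between v
    and v + x. *)
Lemma stein_increment (R : realType) (f g : R -> R) (omega delta v x : R) :
  (forall x : R, is_derive x 1 f (g x)) ->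
  (forall x y, `|x - y| <= delta -> `|g x - g y| <= omega) -> `|x| <= delta ->
  `|f (v + x) - f v - x * g v| <= omega * `|x|.
Proof.
move=> df gomega xd.
have cf := is_derive_continuous df.
have cfab a b : {within `[a, b], continuous f} by exact: continuous_subspaceT.
have [x0|/ltW x0] := leP 0 x.
  have vx : v <= v + x by rewrite lerDl.
  have [c + ->] := MVT_segment vx (fun y _ => df y) (cfab _ _).
  rewrite in_itv/= => /andP[vc cv].
  rewrite (_ : _ - _ = (g c - g v) * x); last by ring.
  rewrite normrM ler_wpM2r// gomega//.
  by rewrite (le_trans _ xd)// !ger0_norm//; lra.
have vx : v + x <= v by rewrite gerDl.
have [c + fE] := MVT_segment vx (fun y _ => df y) (cfab _ _).
rewrite in_itv/= => /andP[vc cv].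
rewrite (_ : _ - _ = (g c - g v) * x); last first.
  by rewrite -(opprB (f v)) fE; ring.
rewrite normrM ler_wpM2r// gomega//.
by rewrite (le_trans _ xd)// !ler0_norm//; lra.
Qed.

Section leave_one_out.
Context d (T : measurableType d) (R : realType) (P : probability T R).
Context (I : eqType).
Implicit Types (xi : I -> T -> R) (l : seq I).

(** The part of mutual independence that Stein's method uses: it is enough that each
    term be independent of the sum of the other ones. *)
Definition loo_indep xi : Prop := forall l i, uniq l -> i \in l ->
  indep_fun P (xi i) (fun w => \sum_(j <- l | j != i) xi j w).

Lemma Rintegral_sum xi l : (forall i, P.-integrable setT (EFin \o xi i)) ->
  P.-integrable setT (EFin \o (fun w => \sum_(i <- l) xi i w)) /\
  \int[P]_w (\sum_(i <- l) xi i w) = \sum_(i <- l) \int[P]_w xi i w.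
Proof.
move=> ixi; elim: l => [|i l [IH1 IH2]].
  split.
    apply: (eq_integrable measurableT (EFin \o cst (0 : R))).
      by move=> w _ /=; rewrite big_nil.
    exact: finite_measure_integrable_cst.
  rewrite big_nil -[RHS](mul0r (fine (P setT))) -Rintegral_cst//.
  by apply: eq_Rintegral => w _; rewrite big_nil.
split.
  apply: (eq_integrable measurableT ((EFin \o xi i) \+
    (EFin \o (fun w => (\sum_(j <- l) xi j w)%R)))%E).
    by move=> w _ /=; rewrite big_cons EFinD.
  exact: integrableD.
rewrite big_cons -IH2 -RintegralD//.
by apply: eq_Rintegral => w _; rewrite big_cons.
Qed.

Lemma norm_sum_le (J : Type) (r : seq J) (p : pred J) (F : J -> R) (delta : R) :
  (forall j, `|F j| <= delta) -> `|\sum_(j <- r | p j) F j| <= (size r)%:R * delta.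
Proof.
move=> Fd; rewrite (le_trans (ler_norm_sum _ _ _))//.
elim: r => [|j r IH]; first by rewrite big_nil mul0r.
have d0 : 0 <= delta by exact: le_trans (normr_ge0 _) (Fd j).
rewrite big_cons /= -natr1 mulrDl mul1r addrC.
by case: ifP => _; rewrite ?lerD// (le_trans IH)// lerDl.
Qed.

Section finite_sum.
Variables (xi : I -> T -> R) (delta : R).
Hypothesis mxi : forall i, measurable_fun setT (xi i).
Hypothesis bxi : forall i w, `|xi i w| <= delta.
Hypothesis cxi : forall i, \int[P]_w xi i w = 0.
Hypothesis ind : loo_indep xi.
Variable l : seq I.
Hypothesis ul : uniq l.

Let S w := \sum_(i <- l) xi i w.
Let V i w := \sum_(j <- l | j != i) xi j w.
Let K := (size l)%:R * delta.

Let SE i w : i \in l -> S w = V i w + xi i w.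
Proof. by move=> il; rewrite /S (bigD1_seq i)//= addrC. Qed.

Let mS : measurable_fun setT S.
Proof. by apply: measurable_sum. Qed.

Let mV i : measurable_fun setT (V i).
Proof.
rewrite (_ : V i = fun w => \sum_(j <- [seq j <- l | j != i]) xi j w).
  by apply: measurable_sum.
by apply/funext => w; rewrite big_filter.
Qed.

Let bS w : `|S w| <= K. Proof. exact: norm_sum_le. Qed.
Let bV i w : `|V i w| <= K. Proof. exact: norm_sum_le. Qed.

Let sq_le i w : `|xi i w ^+ 2| <= delta ^+ 2.
Proof. by rewrite normrX lerXn2r// nnegrE (le_trans _ (bxi i w)). Qed.

Let isq i : P.-integrable setT (EFin \o (fun w => xi i w ^+ 2)).
Proof.
by apply: (@bounded_integrable _ _ _ _ _ (delta ^+ 2)) => //; exact: measurable_funX.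
Qed.

Let sq0 i : 0 <= \int[P]_w xi i w ^+ 2.
Proof. by apply: Rintegral_ge0 => w _; exact: sqr_ge0. Qed.

Let bnd (f : R -> R) (U : T -> R) M : measurable_fun setT f ->
  measurable_fun setT U -> (forall x, `|f x| <= M) ->
  P.-integrable setT (EFin \o (f \o U)).
Proof.
move=> mf mU fM; apply: (@bounded_integrable _ _ _ _ _ M) => [|w]; last exact: fM.
exact: measurableT_comp.
Qed.

Let split_mean (a b : R -> R) A B i : i \in l ->
  measurable_fun setT a -> measurable_fun setT b ->
  (forall w, `|a (xi i w)| <= A) -> (forall w, `|b (V i w)| <= B) ->
  P.-integrable setT (EFin \o (fun w => a (xi i w) * b (V i w))) /\
  \int[P]_w (a (xi i w) * b (V i w)) =
  (\int[P]_w a (xi i w)) * (\int[P]_w b (V i w)).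
Proof.
move=> il ma mb aA bB.
have m1 : measurable_fun setT (a \o xi i) by exact: measurableT_comp.
have m2 : measurable_fun setT (b \o V i) by exact: measurableT_comp.
split.
  apply: (@bounded_integrable _ _ _ _ _ (A * B)); first exact: measurable_funM.
  by move=> w; rewrite normrM ler_pM.
have := @Rintegral_indep_fun _ _ _ P (a \o xi i) (b \o V i) (Num.max A B).
apply => //.
- by move=> w; rewrite le_max aA.
- by move=> w; rewrite le_max bB orbT.
- exact: (indep_fun_comp ma mb (ind ul il)).
Qed.

(** Writing S^2 as the sum of xi_i S and S as V_i + xi_i, the terms xi_i V_i have
    mean 0. *)
Lemma second_moment_sum :
  \int[P]_w (S w ^+ 2) = \sum_(i <- l) \int[P]_w (xi i w ^+ 2).
Proof.
have i1 i : P.-integrable setT (EFin \o (fun w => xi i w * S w)).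
  apply: (@bounded_integrable _ _ _ _ _ (delta * K)); first exact: measurable_funM.
  by move=> w; rewrite normrM ler_pM.
have [_ H] := Rintegral_sum l i1.
rewrite -[LHS](_ : \int[P]_w (\sum_(i <- l) xi i w * S w) = _); last first.
  by apply: eq_Rintegral => w _; rewrite -mulr_suml.
rewrite H big_seq [RHS]big_seq; apply: eq_bigr => i il.
have [i2 E2] := @split_mean id id delta K i il (@measurable_id _ _ _)
  (@measurable_id _ _ _) (bxi i) (bV i).
rewrite cxi mul0r in E2.
rewrite -[RHS]addr0 -E2 -RintegralD//.
by apply: eq_Rintegral => w _; rewrite (SE w il)/=; ring.
Qed.

(** The leave-one-out expansion.  Since xi_i is centred and independent of V_i,
    E[xi_i f(S)] = E[xi_i (f(V_i + xi_i) - f(V_i))], which is E[xi_i^2 g(V_i)] up to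
    omega E[xi_i^2].  Independence splits the latter as E[xi_i^2] E[g(V_i)], and
    replacing V_i by S in g costs omega E[xi_i^2] once more. *)
Lemma finite_stein (f g : R -> R) (M omega : R) :
    (forall x : R, is_derive x 1 f (g x)) -> continuous g ->
    (forall x, `|f x| <= M) -> (forall x, `|g x| <= M) ->
    (forall x y, `|x - y| <= delta -> `|g x - g y| <= omega) ->
  `| \int[P]_w (S w * f (S w)) -
     (\sum_(i <- l) \int[P]_w (xi i w ^+ 2)) * \int[P]_w g (S w) | <=
  2 * omega * \sum_(i <- l) \int[P]_w (xi i w ^+ 2).
Proof.
move=> df cg fM gM gomega.
have cf := is_derive_continuous df.
have mf : measurable_fun setT f by exact: continuous_measurable_fun.
have mg : measurable_fun setT g by exact: continuous_measurable_fun.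
have i1 i : P.-integrable setT (EFin \o (fun w => xi i w * f (S w))).
  apply: (@bounded_integrable _ _ _ _ _ (delta * M)).
    by apply: measurable_funM => //; exact: measurableT_comp.
  by move=> w; rewrite normrM ler_pM.
have [_ H] := Rintegral_sum l i1.
rewrite -[X in X - _](_ : \int[P]_w (\sum_(i <- l) xi i w * f (S w)) = _); last first.
  by apply: eq_Rintegral => w _; rewrite -mulr_suml.
rewrite H mulr_suml -sumrB mulr_sumr.
rewrite (le_trans (ler_norm_sum _ _ _))//.
rewrite big_seq [leRHS]big_seq; apply: ler_sum => i il.
have [i2] := @split_mean id f delta M i il (@measurable_id _ _ _) mf (bxi i)
  (fun w => fM (V i w)).
rewrite cxi mul0r => E2.
have [i3 E3] := @split_mean (fun x => x ^+ 2) g (delta ^+ 2) M i il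
  (measurable_funX 2 (@measurable_id _ _ _)) mg (sq_le i) (fun w => gM (V i w)).
rewrite /= in i2 i3 E2 E3.
have iAB : P.-integrable setT (EFin \o (fun w => xi i w * f (S w) -
    xi i w * f (V i w))).
  exact: integrable_subr.
have igV := bnd mg (mV i) gM.
have igS := bnd mg mS gM.
rewrite (_ : _ - _ = \int[P]_w (xi i w * f (S w) - xi i w * f (V i w)
     - xi i w ^+ 2 * g (V i w))
   + (\int[P]_w xi i w ^+ 2) * \int[P]_w (g (V i w) - g (S w))); last first.
  rewrite !RintegralB// E2 E3; move: (\int[P]_w (xi i w * f (S w))).
  by move=> a; ring.
rewrite (le_trans (ler_normD _ _))//.
have -> : 2 * omega * (\int[P]_w xi i w ^+ 2) =
  \int[P]_w (omega * xi i w ^+ 2) + (\int[P]_w xi i w ^+ 2) * omega.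
  by rewrite RintegralZl//; ring.
have ixg : P.-integrable setT (EFin \o (fun w => xi i w * f (S w) -
    xi i w * f (V i w) - xi i w ^+ 2 * g (V i w))).
  exact: integrable_subr.
apply: lerD.
  rewrite (le_trans (le_normr_Rintegral _ _))//; apply: le_Rintegral => //.
  - by have := integrable_norm ixg; apply: eq_integrable.
  - by have := integrableZl measurableT omega (isq i); apply: eq_integrable.
  move=> w _; rewrite (SE w il).
  rewrite (_ : _ - _ = xi i w * (f (V i w + xi i w) - f (V i w) - xi i w * g (V i w))).
    rewrite normrM -(real_normK (num_real (xi i w))) mulrC expr2 mulrA.
    by rewrite ler_wpM2r//; exact: stein_increment gomega _.
  by ring.
rewrite normrM (ger0_norm (sq0 i)) ler_wpM2l//; apply: norm_Rintegral_le.
  by apply: measurable_funB; exact: measurableT_comp.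
move=> w; apply: gomega; rewrite (SE w il) opprD addrA subrr add0r normrN.
exact: bxi.
Qed.

End finite_sum.
End leave_one_out.

(** * Infinite sums of independent bounded terms *)

Section independent_series.
Context d (T : measurableType d) (R : realType) (P : probability T R).
Context (I : eqType) (Z : I -> T -> R) (M : R) (e : nat -> seq I).
Variables (D Y : T -> R).
Hypothesis mZ : forall i, measurable_fun setT (Z i).
Hypothesis bZ : forall i w, `|Z i w| <= M.
Hypothesis ind : loo_indep P Z.
Hypothesis ue : forall n, uniq (e n).
Hypothesis cvD : forall w, \sum_(i <- e n) Z i w @[n --> \oo] --> D w.
Hypothesis iY : P.-integrable setT (EFin \o Y).
Hypothesis iY2 : P.-integrable setT (EFin \o (fun w => Y w ^+ 2)).
Hypothesis domY : {ae P, forall w, forall n, `|\sum_(i <- e n) Z i w| <= Y w}.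

Let S n w := \sum_(i <- e n) Z i w.
Let c i := \int[P]_w Z i w.
Let C n := \sum_(i <- e n) c i.
Let ED := \int[P]_w D w.

Let mS n : measurable_fun setT (S n).
Proof. exact: measurable_sum. Qed.

Let iZ i : P.-integrable setT (EFin \o Z i).
Proof. exact: bounded_integrable. Qed.

Let ES n : \int[P]_w S n w = C n.
Proof. by have [_ ->] := Rintegral_sum (e n) iZ. Qed.

(** The partial sums converge everywhere and are dominated by Y. *)
Lemma series_mean_cvg : [/\ measurable_fun setT D, P.-integrable setT (EFin \o D) &
  \sum_(i <- e n) \int[P]_w Z i w @[n --> \oo] --> \int[P]_w D w].
Proof.
have [mD iD cv] := Rintegral_dominated_cvg mS cvD iY domY.
by split => //; move: cv; under eq_fun do rewrite ES.
Qed.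

Let v i := \int[P]_w (Z i w - c i) ^+ 2.

Let xi (s : R) i w := (Z i w - c i) / s.

Let bc i : `|c i| <= M.
Proof. exact: norm_Rintegral_le. Qed.

Let mxi s i : measurable_fun setT (xi s i).
Proof. by apply: measurable_funM => //; exact: measurable_funB. Qed.

Let bxi s i w : 0 < s -> `|xi s i w| <= 2 * M / s.
Proof.
move=> s0; rewrite normrM normfV (gtr0_norm s0) ler_wpM2r ?invr_ge0 ?(ltW s0)//.
by rewrite (le_trans (ler_normB _ _))// mulrDl mul1r lerD.
Qed.

Let cxi s i : \int[P]_w xi s i w = 0.
Proof.
have ic : P.-integrable setT (EFin \o (fun w => Z i w - c i)).
  by apply: integrable_subr => //; exact: finite_measure_integrable_cst.
rewrite -[LHS](_ : \int[P]_w (s^-1 * (Z i w - c i)) = _); last first.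
  by apply: eq_Rintegral => w _; rewrite /xi mulrC.
rewrite RintegralZl// RintegralB//; last exact: finite_measure_integrable_cst.
by rewrite Rintegral_cst1 subrr mulr0.
Qed.

Let sum_xi s l w (p : pred I) : \sum_(i <- l | p i) xi s i w =
  (\sum_(i <- l | p i) Z i w - \sum_(i <- l | p i) c i) / s.
Proof. by rewrite -sumrB mulr_suml. Qed.

(* Both xi_i and the sum of the other ones are affine images of the corresponding
   quantities for Z. *)
Let ixi s : loo_indep P (xi s).
Proof.
move=> l i ul il.
have aff (a : R) : measurable_fun setT (fun x : R => (x - a) / s).
  by apply: measurable_funM => //; exact: measurable_funB.
have := indep_fun_comp (aff (c i)) (aff (\sum_(j <- l | j != i) c j)) (ind ul il).
rewrite [X in indep_fun P X _](_ : _ = xi s i)//.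
rewrite [X in indep_fun P _ X](_ : _ = (fun w => \sum_(j <- l | j != i) xi s j w))//.
by apply/funext => w; rewrite sum_xi.
Qed.

Let C_cvg : C n @[n --> \oo] --> ED.
Proof. by have [] := series_mean_cvg. Qed.

(** The centred partial sums have second moment equal to the sum of the variances,
    and their squares are dominated by 2 Y^2 + 2 K^2 with K a bound on the partial
    sums of the means. *)
Lemma series_variance_cvg :
  P.-integrable setT (EFin \o (fun w => (D w - ED) ^+ 2)) /\
  \sum_(i <- e n) \int[P]_w (Z i w - \int[P]_w Z i w) ^+ 2 @[n --> \oo] -->
    \int[P]_w (D w - ED) ^+ 2.
Proof.
have [K CK] : exists K, forall n, `|C n| <= K.
  have /cvg_seq_bounded[K [Kr HK]] := cvgP _ C_cvg.
  by exists (K + 1) => n; apply: HK => //; rewrite ltrDl.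
pose f_ n w := (S n w - C n) ^+ 2.
pose g w := 2 * Y w ^+ 2 + 2 * K ^+ 2.
have mf n : measurable_fun setT (f_ n).
  by apply: measurable_funX; exact: measurable_funB.
have ff w : f_ n w @[n --> \oo] --> (D w - ED) ^+ 2.
  have cvb : S n w - C n @[n --> \oo] --> D w - ED by apply: cvgB => //; exact: cvD.
  rewrite expr2 /f_; under eq_fun do rewrite expr2.
  exact: cvgM.
have ig : P.-integrable setT (EFin \o g).
  by apply: integrable_addr; [exact: integrable_mulr|exact: finite_measure_integrable_cst].
have fg : {ae P, forall w, forall n, `|f_ n w| <= g w}.
  move: domY; apply: filterS => w Yw n; rewrite ger0_norm ?sqr_ge0// /f_ /g.
  have YS : S n w ^+ 2 <= Y w ^+ 2.
    by rewrite -(real_normK (num_real (S n w))) lerXn2r// ?nnegrE// (le_trans _ (Yw n)).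
  have KC : C n ^+ 2 <= K ^+ 2.
    by rewrite -(real_normK (num_real (C n))) lerXn2r// ?nnegrE// (le_trans _ (CK n)).
  have := sqr_ge0 (S n w + C n).
  by move: YS KC; move: (S n w) (C n) => a b; rewrite !expr2; lra.
have [_ iD cv] := Rintegral_dominated_cvg mf ff ig fg.
split => //; rewrite [X in X @ _](_ : _ = (fun n => \int[P]_w f_ n w))//.
apply/funext => n.
have -> : \int[P]_w f_ n w = \int[P]_w (\sum_(i <- e n) xi 1 i w) ^+ 2.
  by apply: eq_Rintegral => w _; rewrite sum_xi divr1.
rewrite (second_moment_sum (delta := 2 * M / 1))//.
- by apply: eq_bigr => i _; apply: eq_Rintegral => w _; rewrite /xi divr1.
- by move=> i w; exact: bxi.
Qed.

Section normalized.
Variable s : R.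
Hypothesis s_gt0 : 0 < s.
Hypothesis sE : s ^+ 2 = \int[P]_w (D w - ED) ^+ 2.

Let W w := (D w - ED) / s.

Let mW : measurable_fun setT W.
Proof.
have [mD _ _] := series_mean_cvg.
by apply: measurable_funM => //; exact: measurable_funB.
Qed.

Lemma series_unit_second_moment : unit_second_moment P W.
Proof.
have [i2 _] := series_variance_cvg.
have s20 : s ^+ 2 != 0 by rewrite expf_neq0// gt_eqF.
have WE w : W w ^+ 2 = s ^- 2 * (D w - ED) ^+ 2 by rewrite /W exprMn exprVn mulrC.
split => //.
  by under eq_fun do rewrite WE; exact: integrable_mulr.
have -> : \int[P]_w W w ^+ 2 = \int[P]_w (s ^- 2 * (D w - ED) ^+ 2).
  by apply: eq_Rintegral => w _.
by rewrite RintegralZl// -sE mulVf.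
Qed.

(** The finite Stein inequality for the partial sums, normalized by the final
    standard deviation s, passes to the limit: all functions involved are bounded
    and continuous, and the variances of the partial sums tend to 1. *)
Lemma series_stein_bound : stein_bound P W (2 * M / s).
Proof.
move=> f g B omega df cg fgB gomega.
have cf := is_derive_continuous df.
have cxf : continuous (fun x : R => x * f x).
  by move=> x; apply: cvgM; [exact: cvg_id|exact: cf].
pose Sx n w := \sum_(i <- e n) xi s i w.
have Sx_W w : Sx n w @[n --> \oo] --> W w.
  rewrite /Sx /W; under eq_fun do rewrite sum_xi.
  by apply: cvgM; [apply: cvgB; [exact: cvD|exact: C_cvg]|exact: cvg_cst].
have mSx n : measurable_fun setT (Sx n) by exact: measurable_sum.
have lim (k : R -> R) : continuous k -> (forall x, `|k x| <= B) ->
    \int[P]_w k (Sx n w) @[n --> \oo] --> \int[P]_w k (W w).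
  move=> ck kB.
  have [||||//] := @Rintegral_dominated_cvg _ _ _ P (fun n w => k (Sx n w))
    (fun w => k (W w)) (cst B).
  - by move=> n; apply: measurableT_comp => //; exact: continuous_measurable_fun.
  - by move=> w; apply: (cvg_comp (Sx ^~ w) k); [exact: Sx_W|exact: ck].
  - exact: finite_measure_integrable_cst.
  - by apply: aeW => w n.
pose vs n := \sum_(i <- e n) \int[P]_w xi s i w ^+ 2.
have vs1 : vs n @[n --> \oo] --> (1 : R).
  have s20 : s ^+ 2 != 0 by rewrite expf_neq0// gt_eqF.
  have [_ cv] := series_variance_cvg.
  suff : vs n @[n --> \oo] --> (\int[P]_w (D w - ED) ^+ 2) / s ^+ 2.
    by rewrite -sE divff.
  have -> : vs = (fun n => (\sum_(i <- e n) v i) / s ^+ 2).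
    apply/funext => n; rewrite mulr_suml; apply: eq_bigr => i _.
    rewrite /v mulrC -RintegralZl//; last first.
      apply: (@bounded_integrable _ _ _ _ _ ((2 * M / 1) ^+ 2)).
        by apply: measurable_funX; exact: measurable_funB.
      move=> w; rewrite normrX lerXn2r ?nnegrE//.
        by rewrite (le_trans _ (bxi i w (@ltr01 R))).
      by have := bxi i w (@ltr01 R); rewrite /xi divr1.
    by apply: eq_Rintegral => w _; rewrite /xi exprMn exprVn mulrC.
  by apply: cvgM; [exact: cv|exact: cvg_cst].
have b1 n := finite_stein (mxi s) (fun i w => bxi i w s_gt0) (cxi s) (@ixi s)
  (ue n) df cg (fun x => let: And3 h _ _ := fgB x in h)
  (fun x => let: And3 _ _ h := fgB x in h) gomega.
have lhs : `|\int[P]_w (Sx n w * f (Sx n w)) - vs n * \int[P]_w g (Sx n w)|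
    @[n --> \oo] --> `|\int[P]_w (W w * f (W w)) - 1 * \int[P]_w g (W w)|.
  apply: cvg_norm; apply: cvgB.
    by apply: (lim (fun x => x * f x)) => // x; case: (fgB x).
  by apply: cvgM => //; apply: lim => // x; case: (fgB x).
have rhs : 2 * omega * vs n @[n --> \oo] --> 2 * omega * 1.
  by apply: cvgM => //; exact: cvg_cst.
rewrite mulr1 in rhs; rewrite mul1r in lhs.
apply: (ler_cvg_to lhs rhs); near=> n; exact: b1.
Unshelve. all: by end_near. Qed.

End normalized.
End independent_series.

(** * Splitting an event along a discrete variable *)

Section split_by_value.
Context d (T : measurableType d) (R : realType) (P : probability T R).
Local Notation pr A := (fine (P A)).

Lemma fine_measure_split (J : eqType) (g : T -> J) (L : seq J) (H : set T) :
  measurable H -> (forall c, measurable [set w | g w = c]) -> uniq L ->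
  pr H = \sum_(c <- L) pr (H `&` [set w | g w = c]) +
    pr (H `&` [set w | g w \notin L]).
Proof.
move=> mH mg; elim: L => [_|c L IH /andP[cL uL]].
  by rewrite big_nil add0r; congr (pr _); apply/seteqP; split => w //= [].
rewrite (IH uL) big_cons (addrC (pr _)) -!addrA; congr (_ + _).
have mN (L' : seq J) : measurable [set w | g w \notin L'].
  elim: L' => [|c' L' mL].
    by rewrite (_ : [set _ | _] = setT)//; apply/seteqP; split.
  rewrite (_ : [set _ | _] = ~` [set w | g w = c'] `&` [set w | g w \notin L']).
    by apply: measurableI => //; exact: measurableC.
  apply/seteqP; split => w /=; rewrite inE negb_or.
    by move=> /andP[/eqP].
  by move=> [/eqP -> ->].
rewrite addrC -fine_measureU; [congr (pr _)|exact: measurableI..|].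
  apply/seteqP; split => w /=.
    move=> [Hw gL]; have [gc|gc] := eqVneq (g w) c; first by right.
    by left; split => //; rewrite inE negb_or gc.
  move=> [[Hw]|[Hw gc]]; last by rewrite gc.
  by rewrite inE negb_or => /andP[].
apply/seteqP; split => w //= -[[_]]; rewrite inE negb_or => /andP[/eqP gc _].
by move=> [_].
Qed.

Lemma fine_measure_series (g : T -> nat) (H : set T) :
  measurable H -> (forall c, measurable [set w | g w = c]) ->
  \sum_(a < N) pr (H `&` [set w | g w = a :> nat]) @[N --> \oo] --> pr H.
Proof.
move=> mH mg.
pose F N := H `&` [set w | (g w < N)%N].
have mF N : measurable (F N).
  apply: measurableI => //.
  rewrite (_ : [set _ | _] = \bigcup_(a in `I_N) [set w | g w = a]).
    exact: bigcup_measurable.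
  apply/seteqP; split => w /=; first by move=> gN; exists (g w).
  by move=> [a /= aN ->].
have FE N : pr (F N) = \sum_(a < N) pr (H `&` [set w | g w = a :> nat]).
  elim: N => [|N IH].
    rewrite big_ord0 (_ : F 0%N = set0) ?measure0//.
    by apply/seteqP; split => w //= [].
  rewrite big_ord_recr /= -IH -fine_measureU//; last 2 first.
  - exact: measurableI.
  - by apply/seteqP; split => w //= -[[_ /=]] + [_ /= gN]; rewrite gN ltnn.
  congr (pr _); apply/seteqP; split => w /=.
    rewrite /F /= ltnS leq_eqVlt => -[Hw /orP[/eqP gN|gN]]; first by right.
    by left.
  by rewrite /F/= => -[[Hw gN]|[Hw ->]]; split => //; rewrite ltnS ltnW.
under eq_fun do rewrite -FE.
apply: fine_cvg; rewrite fineK ?fin_num_measure//.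
have -> : H = \bigcup_N F N.
  apply/seteqP; split => w /=; last by move=> [N _ []].
  by move=> Hw; exists (g w).+1 => //; rewrite /F/=; split => /=.
apply: nondecreasing_cvg_mu => //; first exact: bigcup_measurable.
move=> i j ij; apply/subsetPset => w [Hw /= gi]; split => //=.
exact: leq_trans ij.
Qed.

Section countable_fibers.
Variables (J : countType) (Y : T -> J).
Hypothesis mY : forall y, measurable [set w | Y w = y].

Let g w := choice.pickle (Y w).

Let mg a : measurable [set w | g w = a].
Proof.
have [[y ya]|ny] := pselect (exists y : J, choice.pickle y = a).
  rewrite (_ : [set _ | _] = [set w | Y w = y])//.
  apply/seteqP; split => w /=; last by rewrite /g => ->.
  by rewrite /g -ya => /(pcan_inj choice.pickleK).
rewrite (_ : [set _ | _] = set0)//; apply/seteqP; split => w //= ga.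
by apply: ny; exists (Y w).
Qed.

Lemma measurable_countable_preimage (A : set J) : measurable (Y @^-1` A).
Proof.
rewrite (_ : Y @^-1` A =
    \bigcup_(a in [set choice.pickle y | y in A]) [set w | g w = a]).
  exact: bigcup_measurable.
apply/seteqP; split => w /=.
  by move=> AY; exists (g w) => //; exists (Y w).
by move=> [_ [y Ay <-]] /= /(pcan_inj choice.pickleK) ->.
Qed.

(** Independence from an event passes from the values of a countable variable to all
    events it generates, by summation over the values. *)
Lemma fine_measure_countable_ext (E : set T) (q : R) : measurable E ->
  (forall y, pr ([set w | Y w = y] `&` E) = pr [set w | Y w = y] * q) ->
  forall A : set J, pr (Y @^-1` A `&` E) = pr (Y @^-1` A) * q.
Proof.
move=> mE Yq A.
have mA := measurable_countable_preimage A.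
have c1 := fine_measure_series (measurableI _ _ mA mE) mg.
have c2 := fine_measure_series mA mg.
have c3 : (\sum_(a < N) pr (Y @^-1` A `&` [set w | g w = a :> nat])) * q
    @[N --> \oo] --> pr (Y @^-1` A) * q.
  by apply: cvgM => //; exact: cvg_cst.
suff E_ : (fun N => \sum_(a < N) pr (Y @^-1` A `&` E `&` [set w | g w = a :> nat])) =
    (fun N => (\sum_(a < N) pr (Y @^-1` A `&` [set w | g w = a :> nat])) * q).
  by rewrite E_ in c1; exact: (cvg_unique _ c1 c3).
apply/funext => N; rewrite mulr_suml; apply: eq_bigr => a _; apply/esym.
have [[y [Ay ya]]|ny] := pselect (exists y : J, A y /\ choice.pickle y = a).
  have -> : Y @^-1` A `&` [set w | g w = a :> nat] = [set w | Y w = y].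
    apply/seteqP; split => w /=; last by rewrite /g => ->.
    by rewrite /g -ya => -[_ /(pcan_inj choice.pickleK)].
  rewrite -Yq; congr (pr _); apply/seteqP; split => w /=.
    by rewrite /g => -[-> Ew].
  by rewrite /g -ya => -[[_ Ew] /(pcan_inj choice.pickleK)].
have nw w : A (Y w) -> g w = a -> False by move=> AY ga; apply: ny; exists (Y w).
rewrite (_ : _ `&` [set w | g w = a :> nat] = set0); last first.
  by apply/seteqP; split => w //= [/nw].
rewrite (_ : _ `&` [set w | g w = a :> nat] = set0); last first.
  by apply/seteqP; split => w //= [[/nw]].
by rewrite measure0 mul0r.
Qed.

End countable_fibers.

End split_by_value.

(** * Multinomial weights and Poisson mixtures *)

Section multinomial_weight.
Context {R : realType} (S : choiceType).
Variables (l : seq S) (p : S -> R).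
Hypothesis ul : uniq l.
Implicit Types (k : S -> nat) (a : nat).

Let p0 := 1 - \sum_(s <- l) p s.

Definition total k : nat := \sum_(s <- l) k s.

Definition cell_weight k : R := \prod_(s <- l) (p s ^+ k s / (k s)`!%:R).

(** The probability that, among a independent draws, each species s of l appears
    exactly k s times, when a draw gives s with probability p s and no species of l
    with probability p0. *)
Definition multinomial_weight a k : R :=
  if (total k <= a)%N
  then a`!%:R * (cell_weight k * (p0 ^+ (a - total k) / (a - total k)`!%:R))
  else 0.

(** The counts that remain to be realized after one draw of s. *)
Definition decr k (s : S) : S -> nat := fun u => (k u - (u == s))%N.

Lemma total_decr k s : s \in l -> (0 < k s)%N -> (total (decr k s)).+1 = total k.
Proof.
move=> sl ks; rewrite /total (bigD1_seq s)//= [in RHS](bigD1_seq s)//= /decr eqxx.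
rewrite -addSn subn1 prednK//; congr (_ + _)%N.
by apply: eq_bigr => u /negbTE us; rewrite us subn0.
Qed.

(** p (p^(j-1) / (j-1)!) = j p^j / j!. *)
Lemma cell_weight_decr k s : s \in l -> (0 < k s)%N ->
  p s * cell_weight (decr k s) = (k s)%:R * cell_weight k.
Proof.
move=> sl ks; rewrite /cell_weight (bigD1_seq s)//= [in RHS](bigD1_seq s)//=.
rewrite /decr eqxx !mulrA; congr (_ * _); last first.
  by apply: eq_bigr => u /negbTE us; rewrite us subn0.
case: (k s) ks => // j _; rewrite subn1/= factS natrM exprS.
have j0 : j.+1%:R != 0 :> R by rewrite pnatr_eq0.
have j1 : j`!%:R != 0 :> R by rewrite pnatr_eq0 -lt0n fact_gt0.
by move: j.+1%:R j`!%:R (_ ^+ _) j0 j1 => a b e a0 b0; field; rewrite a0 b0.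
Qed.

Lemma multinomial_weight0 k :
  multinomial_weight 0 k = (all (fun s => k s == 0%N) l)%:R.
Proof.
rewrite /multinomial_weight leqn0 /total.
have -> : (\sum_(s <- l) k s == 0)%N = all (fun s => k s == 0%N) l.
  elim: (l) => [|s l' IH]; first by rewrite big_nil.
  by rewrite big_cons addn_eq0 IH.
case: ifPn => // /allP k0; rewrite /cell_weight big_seq big1 => [|s /k0 /eqP ->].
  by rewrite !sub0n expr0 fact0 divr1 !mulr1.
by rewrite expr0 fact0 divr1.
Qed.

(** The first draw is either no species of l or some s in l.  These cases contribute
    a + 1 - total k and k s times one common term, and the factors add up to
    a + 1. *)
Lemma multinomial_weightS a k :
  multinomial_weight a.+1 k = p0 * multinomial_weight a k +
    \sum_(s <- l) p s * (if (0 < k s)%N then multinomial_weight a (decr k s) else 0).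
Proof.
have tk s : s \in l -> (0 < k s)%N -> (total (decr k s)).+1 = total k by exact: total_decr.
have [ka|ka] := leqP (total k) a.+1; last first.
  rewrite /multinomial_weight leqNgt ka/= leqNgt (ltn_trans _ ka)//= mulr0 add0r.
  rewrite big_seq big1// => s sl; case: ifPn => ks; last by rewrite mulr0.
  by rewrite leqNgt -ltnS tk// ka mulr0.
pose g := p0 ^+ (a.+1 - total k) / (a.+1 - total k)`!%:R.
have -> : \sum_(s <- l) p s * (if (0 < k s)%N then multinomial_weight a (decr k s) else 0)
    = \sum_(s <- l) (k s)%:R * (a`!%:R * (cell_weight k * g)).
  rewrite big_seq [RHS]big_seq; apply: eq_bigr => s sl; case: ifPn => ks; last first.
    by move: ks; rewrite lt0n negbK => /eqP ->; rewrite mulr0 mul0r.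
  rewrite /multinomial_weight -ltnS tk// ka -subSS tk// -/g.
  by rewrite mulrCA mulrA [in LHS]mulrA mulrA -[_ * p s * _]mulrA cell_weight_decr//; ring.
rewrite -mulr_suml -natr_sum -/(total k).
have -> : p0 * multinomial_weight a k =
    (a.+1 - total k)%:R * (a`!%:R * (cell_weight k * g)).
  rewrite /multinomial_weight; case: ifPn => [ka'|].
    rewrite /g subSn// factS natrM exprS invfM.
    have j0 : (a - total k).+1%:R != 0 :> R by rewrite pnatr_eq0.
    have j1 : (a - total k)`!%:R != 0 :> R by rewrite pnatr_eq0 -lt0n fact_gt0.
    move: j0 j1; move: (a - total k).+1%:R (a - total k)`!%:R => x y x0 y0.
    by field; rewrite x0 y0.
  rewrite -ltnNge => ak; have -> : (a.+1 - total k = 0)%N by apply/eqP; rewrite subn_eq0.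
  by rewrite mulr0 mul0r.
rewrite -mulrDl -natrD subnK// [RHS]mulrA -natrM -factS /multinomial_weight ka.
by rewrite /g.
Qed.

(** The weight vanishes for a < total k.  Once the index is shifted by total k, the
    factorial a! cancels against the Poisson weight, and what remains is a constant
    times the exponential series at t p0. *)
Lemma poisson_mixture_weight (t : R) k : 0 < t ->
  \sum_(a < N) poisson_pmf t a * multinomial_weight a k @[N --> \oo] -->
  \prod_(s <- l) ((t * p s) ^+ k s / (k s)`!%:R * expR (- (t * p s))).
Proof.
move=> t0.
pose c := expR (- t) * t ^+ total k * cell_weight k.
have cE : c * expR (t * p0) = \prod_(s <- l) ((t * p s) ^+ k s / (k s)`!%:R * expR (- (t * p s))).
  have e2 : \prod_(s <- l) expR (- (t * p s)) = expR (\sum_(s <- l) - (t * p s)).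
    by rewrite expR_sum.
  rewrite /c /cell_weight [RHS]big_split/= e2.
  have -> : \prod_(s <- l) ((t * p s) ^+ k s / (k s)`!%:R) =
      t ^+ total k * \prod_(s <- l) (p s ^+ k s / (k s)`!%:R).
    under eq_bigr do rewrite exprMn -mulrA.
    rewrite big_split/=; congr (_ * _); rewrite /total.
    by elim: (l) => [|s l' IH]; rewrite ?big_nil ?expr0// !big_cons exprD IH.
  have -> : t * p0 = t + \sum_(s <- l) - (t * p s).
    by rewrite sumrN -mulr_sumr /p0; ring.
  by rewrite expRD expRN; have := expR_gt0 t; move=> /lt0r_neq0 e0; field.
rewrite -cE -(cvg_shiftn (total k)).
have -> : (fun N => \sum_(a < N + total k) poisson_pmf t a * multinomial_weight a k) =
    (fun N => c * series (exp_coeff (t * p0)) N).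
  apply/funext => N; rewrite /series/= mulr_sumr.
  rewrite -(big_mkord xpredT (fun a => poisson_pmf t a * multinomial_weight a k)).
  rewrite (big_cat_nat (n := total k)) ?leq_addl//= big_nat big1 ?add0r; last first.
    move=> a /andP[_ ak]; rewrite /multinomial_weight leqNgt ak/= mulr0//.
  rewrite -{1}[total k]add0n big_addn addnK; apply: eq_bigr => a _.
  rewrite /multinomial_weight leq_addl addnK /poisson_pmf t0 /exp_coeff/= /c.
  have j0 : (a + total k)`!%:R != 0 :> R by rewrite pnatr_eq0 -lt0n fact_gt0.
  have j1 : a`!%:R != 0 :> R by rewrite pnatr_eq0 -lt0n fact_gt0.
  by rewrite exprD exprMn; field; rewrite j0 j1.
apply: cvgM; first exact: cvg_cst.
by have := @is_cvg_series_exp_coeff R (t * p0); rewrite /expR.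
Qed.

End multinomial_weight.

(** * Enumerating the species *)

Section enumeration.
Variable S : countType.

(** The first species in the order of their codes; species are summed along this
    exhaustion by finite duplicate-free lists. *)
Definition enum_upto (K : nat) : seq S := pmap (@choice.pickle_inv S) (iota 0 K).

Lemma enum_upto_uniq K : uniq (enum_upto K).
Proof. by rewrite /enum_upto (pmap_uniq (@choice.pickle_invK S)) ?iota_uniq. Qed.

Lemma mem_enum_upto K s : (s \in enum_upto K) = (choice.pickle s < K)%N.
Proof.
by rewrite (can2_mem_pmap (@choice.pickle_invK S) (@choice.pickleK_inv S)) mem_iota.
Qed.

Lemma fsbig_enum_upto (V : nmodType) (f : S -> V) K :
  (forall s, s \notin enum_upto K -> f s = 0) ->
  \sum_(s \in [set: S]) f s = \sum_(s <- enum_upto K) f s.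
Proof.
move=> f0; rewrite (fsbigE (enum_upto K))//; last 2 first.
- exact: enum_upto_uniq.
- by move=> i _; exact: f0.
by apply: eq_bigl => i; rewrite in_setT.
Qed.

Lemma card_fset_set_enum_upto (A : set S) K : A `<=` [set` enum_upto K] ->
  #|` fset_set A| = (\sum_(s <- enum_upto K) (s \in A))%N.
Proof.
move=> AK.
have fA : finite_set A by apply: sub_finite_set AK _; exact: finite_seq.
rewrite -[RHS]big_mkcond sum1_count -size_filter; apply/perm_size/uniq_perm.
- exact: fset_uniq.
- by rewrite filter_uniq// enum_upto_uniq.
move=> s; rewrite mem_filter -[LHS]/(s \in fset_set A) in_fset_set//.
by case: (boolP (s \in A)) => //= /set_mem/AK.
Qed.

End enumeration.

(** * Second moment of a Poisson variable *)

Section poisson_moment.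
Context d (T : measurableType d) (R : realType) (P : probability T R).
Variables (N : {RV P >-> nat}) (x : R).
Hypothesis x_gt0 : 0 < x.
Hypothesis lawN : forall k, distribution P N [set k] = (poisson_pmf x k)%:E.

Lemma measurable_natr_RV : measurable_fun setT (fun w => (N w)%:R : R).
Proof.
move=> _ B mB; rewrite setTI.
exact: (@measurable_funPTI _ _ _ _ N [set k : nat | B k%:R]).
Qed.

Let square_le_exp (k : nat) : (k%:R ^+ 2 : R) <= 4 ^+ k.
Proof.
have -> : (4 : R) = 2 ^+ 2 by rewrite -natrX.
rewrite -exprM mulnC exprM lerXn2r ?nnegrE// ?exprn_ge0// -natrX ler_nat.
by rewrite ltnW// ltn_expl.
Qed.

(** As k^2 <= 4^k, the second moment is at most exp(-x) exp(4 x). *)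
Lemma integrable_square_poisson : P.-integrable setT (EFin \o (fun w => (N w)%:R ^+ 2)).
Proof.
apply/integrableP; split.
  by apply/measurable_EFinP; apply: measurable_funX; exact: measurable_natr_RV.
pose F k := N @^-1` [set k].
have mF k : measurable (F k) by exact: measurable_funPTI.
have UF : setT = \bigcup_k F k by apply/seteqP; split => // w _; exists (N w).
have tF : trivIset setT F.
  apply/trivIsetP => i j _ _ /eqP ij; apply/seteqP; split => w // [Ni Nj].
  by apply: ij; rewrite -(Ni : N w = i) -(Nj : N w = j).
rewrite UF ge0_integral_bigcup//; last first.
  apply: measurableT_comp => //; apply/measurable_EFinP; apply: measurable_funTS.
  by apply: measurable_funX; exact: measurable_natr_RV.
have term k : (\int[P]_(w in F k) `|((N w)%:R ^+ 2)%:E| = (k%:R ^+ 2 * poisson_pmf x k)%:E)%E.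
  rewrite (eq_integral (fun=> (k%:R ^+ 2)%:E)); last first.
    by move=> w; rewrite inE => -> /=; rewrite ger0_norm// sqr_ge0.
  by rewrite integral_cst// [RHS]EFinM; congr (_ * _)%E; exact: lawN.
rewrite (eq_eseriesr (fun k _ => term k)).
pose B := expR (- x) * expR (4 * x).
apply: (@le_lt_trans _ _ B%:E); last exact: ltry.
apply: lime_le.
  by apply: is_cvg_nneseries => k _ _; rewrite lee_fin mulr_ge0 ?sqr_ge0 ?poisson_pmf_ge0.
apply: nearW => k; rewrite sumEFin lee_fin.
apply: (@le_trans _ _ (expR (- x) * series (exp_coeff (4 * x)) k)).
  rewrite /series/= mulr_sumr; apply: ler_sum => i _.
  rewrite /poisson_pmf x_gt0 /exp_coeff/= exprMn.
  rewrite [leLHS](_ : _ = expR (- x) * (i%:R ^+ 2 * (x ^+ i / i`!%:R))); last by ring.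
  rewrite -[X in _ <= _ * X]mulrA ler_wpM2l ?expR_ge0// ler_wpM2r//.
  by rewrite divr_ge0// exprn_ge0// ltW.
rewrite ler_wpM2l ?expR_ge0//; apply: nondecreasing_cvgn_le; last first.
  exact: is_cvg_series_exp_coeff.
apply: nondecreasing_series => i _ _; apply: exp_coeff_ge0.
by rewrite mulr_ge0// ltW.
Qed.

End poisson_moment.

(** * Order-free sums along an enumeration *)

Section esum_enum.
Context {R : realType} (S : countType).
Implicit Types (f : S -> R) (l : R).

Lemma nondecreasing_enum_sum f : (forall s, 0 <= f s) ->
  nondecreasing_seq (fun K => \sum_(s <- enum_upto S K) f s).
Proof.
move=> f0; apply/nondecreasing_seqP => K.
rewrite {2}/enum_upto -addn1 iotaD pmap_cat big_cat/= lerDl.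
by rewrite sumr_ge0.
Qed.

(** A finite subset of S is contained in some [enum_upto S K], so the supremum over
    finite sets is the limit along the enumeration. *)
Lemma esum_enum_cvg f l : (forall s, 0 <= f s) ->
  \sum_(s <- enum_upto S K) f s @[K --> \oo] --> l ->
  (\esum_(s in [set: S]) (f s)%:E = l%:E)%E.
Proof.
move=> f0 fl.
have le_l K : \sum_(s <- enum_upto S K) f s <= l.
  rewrite -(cvg_lim (@Rhausdorff R) fl).
  by apply: nondecreasing_cvgn_le; [exact: nondecreasing_enum_sum|exact: cvgP fl].
apply/eqP; rewrite eq_le; apply/andP; split.
  apply: ge_ereal_sup => _ [F [finF _] <-].
  rewrite fsumEFin// lee_fin fsbig_mkcond.
  pose K := (\max_(s <- enum_fset (fset_set F)) (choice.pickle s).+1)%N.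
  rewrite (@fsbig_enum_upto _ _ _ K).
    apply: le_trans (le_l K); apply: ler_sum => s _.
    by rewrite patchE; case: ifP.
  move=> s; rewrite mem_enum_upto -leqNgt patchE => Ks; case: ifP => // /set_mem Fs.
  have : s \in enum_fset (fset_set F).
    by rewrite -[_ \in _]/(s \in fset_set F) in_fset_set// mem_set.
  move=> /(@leq_bigmax_seq _ _ xpredT (fun s => (choice.pickle s).+1)) /(_ isT).
  by rewrite leqNgt ltnS Ks.
have ge K : ((\sum_(s <- enum_upto S K) f s)%:E <= \esum_(s in [set: S]) (f s)%:E)%E.
  apply: esum_ge; exists [set` enum_upto S K].
    by split => //; exact: finite_seq.
  by rewrite -fsbig_seq ?enum_upto_uniq// sumEFin.
case E : (\esum_(s in [set: S]) (f s)%:E)%E ge => [r| |] ge.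
- rewrite lee_fin; apply: (cvgr_to_le fl); near=> K.
  by have := ge K; rewrite lee_fin.
- by rewrite leey.
- by have := ge 0%N; rewrite leeNy_eq.
Unshelve. all: by end_near. Qed.

(** Absolute summability makes the positive and the negative part converge
    separately. *)
Lemma signed_esum_enum_cvg f l A :
  \sum_(s <- enum_upto S K) f s @[K --> \oo] --> l ->
  (forall K, \sum_(s <- enum_upto S K) `|f s| <= A) ->
  signed_esum (fun s => (f s)%:E) = l%:E.
Proof.
move=> fl fA.
pose fp s := Num.max (f s) 0; pose fn s := Num.max (- f s) 0.
have fp0 s : 0 <= fp s by rewrite le_max lexx orbT.
have fn0 s : 0 <= fn s by rewrite le_max lexx orbT.
have cvg_part g : (forall s, 0 <= g s) -> (forall s, g s <= `|f s|) ->
    cvgn (fun K => \sum_(s <- enum_upto S K) g s).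
  move=> g0 gf; apply: nondecreasing_is_cvgn; first exact: nondecreasing_enum_sum.
  exists A => _ [K _ <-]; apply: le_trans (fA K); exact: ler_sum.
have cp : cvgn (fun K => \sum_(s <- enum_upto S K) fp s).
  by apply: cvg_part => // s; rewrite ge_max ler_norm normr_ge0.
have cn : cvgn (fun K => \sum_(s <- enum_upto S K) fn s).
  by apply: cvg_part => // s; rewrite ge_max -normrN ler_norm normr_ge0.
have ep := esum_enum_cvg fp0 cp; have en := esum_enum_cvg fn0 cn.
rewrite /signed_esum.
have -> : (\esum_(s in [set: S]) (fun s => (f s)%:E)^\+ s)%E =
    (\esum_(s in [set: S]) (fp s)%:E)%E.
  by apply: eq_esum => s _; rewrite funeposE /fp EFin_max.
have -> : (\esum_(s in [set: S]) (fun s => (f s)%:E)^\- s)%E =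
    (\esum_(s in [set: S]) (fn s)%:E)%E.
  by apply: eq_esum => s _; rewrite funenegE /fn EFin_max EFinN.
rewrite ep en -EFinB; congr (_%:E).
apply: (cvg_unique _ (cvgB cp cn)) => //.
rewrite (_ : _ - _ = (fun K => \sum_(s <- enum_upto S K) f s))//.
apply/funext => K.
transitivity (\sum_(s <- enum_upto S K) fp s - \sum_(s <- enum_upto S K) fn s) => //.
rewrite -sumrB; apply: eq_bigr => s _; rewrite /fp /fn.
have [f0|f0] := leP 0 (f s).
  by rewrite max_r ?subr0// oppr_le0.
by rewrite max_l ?sub0r ?opprK// oppr_ge0 ltW.
Qed.

End esum_enum.

(** * Studentization by an estimated variance *)

(** v - 1 = (sqrt v - 1) (sqrt v + 1) and the last factor is at least 1. *)
Lemma sqrtr_sub1_le (R : rcfType) (v : R) : 0 <= v -> `|Num.sqrt v - 1| <= `|v - 1|.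
Proof.
move=> v0; have s0 := sqrtr_ge0 v.
have -> : v - 1 = (Num.sqrt v - 1) * (Num.sqrt v + 1).
  by rewrite -{1}(sqr_sqrtr v0); ring.
rewrite normrM ler_peMr// ger0_norm; lra.
Qed.

Section studentization.
Context d (T : measurableType d) (R : realType) (P : probability T R).
Local Notation pr A := (fine (P A)).

Section estimated_variance.
Variables (D V : T -> R) (sigma mean c x kappa eta : R).
Hypothesis mD : measurable_fun setT D.
Hypothesis mV : measurable_fun setT V.
Hypothesis sigma_gt0 : 0 < sigma.
Hypothesis kappa01 : 0 < kappa < 1.
Hypothesis V_close : pr [set w | kappa <= `|V w / sigma ^+ 2 - 1|] <= eta.

Let W w := (D w - mean) / sigma.
Let Z w := if 0 < V w then (D w - mean) / Num.sqrt (V w) else c.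
Let bad := [set w | kappa <= `|V w / sigma ^+ 2 - 1|].

Let mbad : measurable bad.
Proof.
apply: measurable_superlevel; apply: measurableT_comp => //.
by apply: measurable_funB => //; exact: measurable_funM.
Qed.

Let mW y : measurable (W @^-1` `]-oo, y]).
Proof.
rewrite -[X in measurable X]setTI.
have mW' : measurable_fun setT W by apply: measurable_funM => //; exact: measurable_funB.
exact: mW'.
Qed.

(** Where V is positive the event reads D - mean <= x sqrt V; elsewhere it is
    everything or nothing, according to c. *)
Lemma measurable_studentized_le : measurable (Z @^-1` `]-oo, x]).
Proof.
pose pos := V @^-1` `]0, +oo[.
have mpos : measurable pos by rewrite -[X in measurable X]setTI; exact: mV.
pose g w := D w - mean - x * Num.sqrt (V w).
have mg : measurable_fun setT g.
  apply: measurable_funB; first exact: measurable_funB.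
  apply: measurable_funM => //; apply: (measurableT_comp (f := @Num.sqrt R)) => //.
  by apply: continuous_measurable_fun => y; exact: sqrt_continuous.
have mg0 : measurable (g @^-1` `]-oo, 0]) by rewrite -[X in measurable X]setTI; exact: mg.
rewrite (_ : Z @^-1` _ = (pos `&` g @^-1` `]-oo, 0]) `|`
    (if c <= x then ~` pos else set0)).
  apply: measurableU; first exact: measurableI.
  by case: ifP => _; [exact: measurableC|exact: measurable0].
apply/seteqP; split => w; rewrite /Z /pos /g /=.
  rewrite !in_itv/= andbT; case: ifPn => V0.
    by rewrite ler_pdivrMr ?sqrtr_gt0// => h; left; split => //; rewrite subr_le0.
  by move=> cx; right; rewrite cx /= in_itv/= andbT; exact/negP.
rewrite !in_itv/= andbT => -[[V0]|].
  by rewrite V0 subr_le0 ler_pdivrMr ?sqrtr_gt0.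
case: ifPn => // cx; rewrite /= in_itv/= andbT => /negP/negbTE V0.
by rewrite V0.
Qed.

(* r is sqrt (V / sigma^2), the factor between the two normalizations. *)
Let good w : ~ bad w -> exists2 r, `|r - 1| <= kappa &
  (Z w <= x) = (W w <= x * r).
Proof.
move=> /negP; rewrite -ltNge => vk; set v := V w / sigma ^+ 2 in vk.
have /andP[k0 k1] := kappa01.
have s20 : 0 < sigma ^+ 2 by rewrite exprn_gt0.
have v0 : 0 < v by move: vk; rewrite ltr_norml => /andP[+ _]; lra.
have VE : V w = v * sigma ^+ 2 by rewrite /v divfK// gt_eqF.
exists (Num.sqrt v); first by rewrite (le_trans (sqrtr_sub1_le (ltW v0)))// ltW.
have V0 : 0 < V w by rewrite VE mulr_gt0.
have sv0 : 0 < Num.sqrt v by rewrite sqrtr_gt0.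
rewrite /Z V0 VE sqrtrM ?(ltW v0)// sqrtr_sqr (gtr0_norm sigma_gt0) /W.
by rewrite invfM mulrA mulrAC ler_pdivrMr.
Qed.

(** Off the bad event, Z <= x means W <= x r with |r - 1| <= kappa. *)
Lemma studentized_cdf :
  pr (W @^-1` `]-oo, x - `|x| * kappa]) - eta <= pr (Z @^-1` `]-oo, x]) <=
  pr (W @^-1` `]-oo, x + `|x| * kappa]) + eta.
Proof.
have close r : `|r - 1| <= kappa -> x - `|x| * kappa <= x * r <= x + `|x| * kappa.
  move=> rk; rewrite -ler_distl (_ : x * r - x = x * (r - 1)); last by ring.
  by rewrite normrM ler_wpM2l.
have lo : W @^-1` `]-oo, x - `|x| * kappa] `<=` Z @^-1` `]-oo, x] `|` bad.
  move=> w /=; rewrite !in_itv/= => Ww.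
  have [bw|/good[r /close /andP[r1 r2] Zr]] := pselect (bad w); [by right|left].
  by rewrite Zr (le_trans Ww).
have up : Z @^-1` `]-oo, x] `<=` W @^-1` `]-oo, x + `|x| * kappa] `|` bad.
  move=> w /=; rewrite !in_itv/= => Zw.
  have [bw|/good[r /close /andP[r1 r2] Zr]] := pselect (bad w); [by right|left].
  by rewrite (le_trans _ r2)// -Zr.
have lo_le := @fine_measure_leU _ _ _ P _ _ _ (mW _) measurable_studentized_le mbad lo.
have up_le := @fine_measure_leU _ _ _ P _ _ _ measurable_studentized_le (mW _) mbad up.
rewrite lerBlDr; apply/andP; split.
  exact: le_trans lo_le (lerD (lexx _) V_close).
exact: le_trans up_le (lerD (lexx _) V_close).
Qed.

End estimated_variance.
End studentization.

(** * Poisson splitting *)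

Section poisson_splitting.
Context (R : realType) (S : countType) (mu : probability {fset S} R) (t t' : R).
Context (d : measure_display) (Omega : measurableType d) (P : probability Omega R).
Context (X : nat -> {RV P >-> {fset S}}) (n m : {RV P >-> nat}).
Hypothesis t_gt0 : 0 < t.
Hypothesis t'_gt0 : 0 < t'.
Hypothesis sampling : poisson_sampling mu t t' X n m.
Hypothesis mu_prec1 : at_most_one_species mu.
Local Notation pr A := (fine (P A)).

Definition species_prob (s : S) : R := fine (mu [set A : {fset S} | s \in A]).

Lemma measurable_preX (i : nat) (A : set {fset S}) : measurable (X i @^-1` A).
Proof. exact: measurable_funPTI. Qed.

Lemma measurable_preN (N : {RV P >-> nat}) (A : set nat) : measurable (N @^-1` A).
Proof. exact: measurable_funPTI. Qed.

Lemma pr_X (i : nat) (A : set {fset S}) : pr (X i @^-1` A) = fine (mu A).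
Proof. by rewrite -(ps_law_X sampling i A). Qed.

Definition rect (A : nat -> set {fset S}) (i0 : nat) (B C : set nat) : set Omega :=
  (\bigcap_(i in `I_i0) X i @^-1` A i) `&` (n @^-1` B `&` m @^-1` C).

Lemma measurable_rect A i0 B C : measurable (rect A i0 B C).
Proof.
apply: measurableI.
  rewrite bigcap_mkord; apply: bigsetI_measurable => i _; exact: measurable_preX.
by apply: measurableI; exact: measurable_preN.
Qed.

Lemma pr_rect A i0 B C : pr (rect A i0 B C) =
  (\prod_(i < i0) fine (mu (A i))) * (pr (n @^-1` B) * pr (m @^-1` C)).
Proof.
rewrite /rect (ps_indep sampling) -[in LHS](fineK (fin_num_measure P _ (measurable_preN n B))).
rewrite -[in LHS](fineK (fin_num_measure P _ (measurable_preN m C))).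
have -> : (\prod_(i < i0) P (X i @^-1` A i))%E = (\prod_(i < i0) fine (mu (A i)))%:E.
  elim: i0 => [|i0 IH]; first by rewrite !big_ord0.
  rewrite !big_ord_recr/= IH EFinM; congr (_ * _)%E.
  by rewrite -(pr_X i0) fineK// fin_num_measure//; exact: measurable_preX.
by rewrite -!EFinM.
Qed.

(** The position of A relative to l: [Some (Some s)] when s is the only species of l in
    A, [Some None] when there is none, and [None] when there are several, which has
    probability zero. *)
Definition cell (l : seq S) (A : {fset S}) : option (option S) :=
  match [seq s <- l | s \in A] with
  | [::] => Some None
  | [:: s] => Some (Some s)
  | _ => None
  end.

(** The codes of the finite sets exhibit the event as a countable union of sets with
    at most one point, all of them null. *)
Lemma mu_many : mu [set A : {fset S} | (1 < #|` A|)%N] = 0%E.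
Proof.
apply: (@measure_negligible _ _ _ mu) => //.
have -> : [set A : {fset S} | (1 < #|` A|)%N] =
    \bigcup_k [set A : {fset S} | (1 < #|` A|)%N /\ choice.pickle (enum_fset A) = k].
  apply/seteqP; split => [A A1|A [k _ []//]].
  by exists (choice.pickle (enum_fset A)).
apply: negligible_bigcup => k.
have [[A [A1 Ak]]|nA] := pselect (exists A : {fset S},
    (1 < #|` A|)%N /\ choice.pickle (enum_fset A) = k).
  exists [set A]; split; [by []|exact: mu_prec1|].
  move=> B [B1 Bk]; apply/fsetP => x.
  have : enum_fset B = enum_fset A by apply: (pcan_inj choice.pickleK); rewrite Ak.
  by move=> BA; rewrite -[x \in B]/(x \in enum_fset B) BA.
apply: (negligibleS _ (negligible_set0 _)) => B HB.
by apply: nA; exists B.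
Qed.

Lemma mu_bad_cell l : uniq l -> mu [set A : {fset S} | cell l A = None] = 0%E.
Proof.
move=> ul; apply/eqP; rewrite eq_le measure_ge0 andbT -mu_many.
apply: le_measure; rewrite ?inE// => A /=; rewrite /cell.
case E : [seq s <- l | s \in A] => [//|s [//|u r]] _.
have : (size (s :: u :: r) <= #|` A|)%N.
  rewrite -E; apply: uniq_leq_size; first exact: filter_uniq.
  by move=> x; rewrite mem_filter => /andP[].
by apply: leq_trans.
Qed.

Lemma cell_someP l A s : uniq l -> cell l A = Some (Some s) ->
  s \in l /\ (forall u, u \in l -> (u \in A) = (u == s)).
Proof.
move=> ul; rewrite /cell.
case E : [seq s <- l | s \in A] => [//|u [|//]] [us]; subst u.
have mf u : (u \in l) && (u \in A) = (u == s).
  by have := mem_filter (mem A) u l; rewrite andbC /= E inE => ->.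
split; first by have := mf s; rewrite eqxx => /andP[].
by move=> u ul'; rewrite -mf ul'.
Qed.

Lemma cell_noneP l A : cell l A = Some None -> forall u, u \in l -> u \in A = false.
Proof.
rewrite /cell; case E : [seq s <- l | s \in A] => [|u [|//]]// _ u ul.
apply/negbTE/negP => uA.
by have := mem_filter (mem A) u l; rewrite /= uA ul E.
Qed.

Lemma mu_cell_some l s : uniq l -> s \in l ->
  fine (mu [set A : {fset S} | cell l A = Some (Some s)]) = species_prob s.
Proof.
move=> ul sl; rewrite /species_prob.
have -> : [set A : {fset S} | s \in A] =
  [set A : {fset S} | cell l A = Some (Some s)] `|`
    ([set A : {fset S} | cell l A = None] `&` [set A : {fset S} | s \in A]).
  apply/seteqP; split => A /=.
    move=> sA; case E : (cell l A) => [[u|]|]; [left|left|by right].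
      have [_ /(_ s sl)] := cell_someP ul E.
      by rewrite sA => /esym/eqP ->.
    by have := cell_noneP E sl; rewrite sA.
  move=> [E|[]//]; have [_ /(_ s sl)] := cell_someP ul E.
  by rewrite eqxx.
rewrite fine_measureU//; last by apply/seteqP; split => A //= [->] [].
have -> : mu ([set A : {fset S} | cell l A = None] `&` [set A : {fset S} | s \in A]) = 0%E.
  apply/eqP; rewrite eq_le measure_ge0 andbT -(mu_bad_cell ul).
  by apply: le_measure; rewrite ?inE// => A [].
by rewrite addr0.
Qed.

Definition cells (l : seq S) : seq (option (option S)) :=
  Some None :: [seq Some (Some s) | s <- l].

Lemma uniq_cells l : uniq l -> uniq (cells l).
Proof.
move=> ul; rewrite /cells /= map_inj_uniq ?ul ?andbT//; last by move=> x y [].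
by apply/mapP => -[].
Qed.

Lemma cells_notin l A : uniq l -> cell l A \notin cells l -> cell l A = None.
Proof.
move=> ul; case E : (cell l A) => [[s|]|]//.
  have [sl _] := cell_someP ul E.
  by rewrite /cells inE/= map_f.
Qed.

Lemma mu_cell_none l : uniq l -> fine (mu [set A : {fset S} | cell l A = Some None]) =
  1 - \sum_(s <- l) species_prob s.
Proof.
move=> ul; apply/eqP; rewrite eq_sym subr_eq; apply/eqP.
have := @fine_measure_split _ _ _ mu _ (cell l) (cells l) setT measurableT _ (uniq_cells ul).
rewrite (@probability_setT _ _ _ mu)/= => -> //.
rewrite [X in _ + X](_ : _ = 0); last first.
  rewrite [X in fine X](_ : _ = 0%E)//.
  apply/eqP; rewrite eq_le measure_ge0 andbT -(mu_bad_cell ul).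
  apply: le_measure; rewrite ?inE// => A [_] /=; exact: cells_notin.
rewrite addr0 /cells big_cons big_map setTI; congr (_ + _).
rewrite big_seq [RHS]big_seq; apply: eq_bigr => s sl.
by rewrite setTI mu_cell_some.
Qed.

(** E has probability q and is independent of the sample sizes and of the draws before
    i0.  This one-sided notion is what an induction that peels off draws one at a
    time can carry. *)
Definition factors (i0 : nat) (E : set Omega) (q : R) : Prop :=
  measurable E /\ forall A B C,
    pr (rect A i0 B C `&` E) = pr (rect A i0 B C) * q.

Lemma factorsT i0 : factors i0 setT 1.
Proof. by split => // A B C; rewrite setIT mulr1. Qed.

Lemma factors0 i0 : factors i0 set0 0.
Proof. by split => // A B C; rewrite setI0 measure0 mulr0. Qed.

(** Conditioning on the cell of draw i0: given that cell c, the event F coincides with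
    an event E c that depends on later draws only. *)
Lemma factors_peel l i0 (F : set Omega) (E : option (option S) -> set Omega)
    (q : option (option S) -> R) : uniq l -> measurable F ->
  (forall c, c \in cells l -> factors i0.+1 (E c) (q c)) ->
  (forall w c, c \in cells l -> cell l (X i0 w) = c -> F w <-> E c w) ->
  factors i0 F ((1 - \sum_(s <- l) species_prob s) * q (Some None) +
     \sum_(s <- l) species_prob s * q (Some (Some s))).
Proof.
move=> ul mF Eq FE; split => // A B C.
have mcell c : measurable [set w | cell l (X i0 w) = c].
  exact: (measurable_preX i0 [set A : {fset S} | cell l A = c]).
have mR := measurable_rect A i0 B C.
have := @fine_measure_split _ _ _ P _ (fun w => cell l (X i0 w)) (cells l)
  (rect A i0 B C `&` F) (measurableI _ _ mR mF) mcell (uniq_cells ul).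
move=> ->; rewrite [X in _ + X](_ : _ = 0); last first.
  rewrite [X in fine X](_ : _ = 0%E)//.
  apply/eqP; rewrite eq_le measure_ge0 andbT.
  have <- : P (X i0 @^-1` [set A : {fset S} | cell l A = None]) = 0%E.
    by have := ps_law_X sampling i0 [set A : {fset S} | cell l A = None]; rewrite mu_bad_cell.
  apply: le_measure; rewrite ?inE//.
  - apply: measurableI; first exact: measurableI.
    exact: (measurable_preX i0 [set A : {fset S} | cell l A \notin cells l]).
  - exact: measurable_preX.
  - by move=> w [_] /=; exact: cells_notin.
rewrite addr0.
have term c : c \in cells l ->
    pr (rect A i0 B C `&` F `&` [set w | cell l (X i0 w) = c]) =
    pr (rect A i0 B C) * (fine (mu [set A : {fset S} | cell l A = c]) * q c).
  move=> cl; have [mE Ec] := Eq c cl.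
  (* Prescribing the cell of draw i0 extends the rectangle by one coordinate. *)
  pose A' i := if i == i0 then [set A : {fset S} | cell l A = c] else A i.
  have recE : rect A' i0.+1 B C = rect A i0 B C `&` [set w | cell l (X i0 w) = c].
    apply/seteqP; split => w.
      move=> [H1 H2]; split.
        split => // i /= ii0; have := H1 i; rewrite /= /A' ltnS (ltnW ii0) => /(_ isT).
        by rewrite ltn_eqF.
      by have := H1 i0; rewrite /= /A' ltnSn eqxx => /(_ isT).
    move=> [[H1 H2] H3]; split => // i /=; rewrite ltnS leq_eqVlt /A'.
    case/orP => [/eqP ->|ii0]; first by rewrite eqxx.
    by rewrite ltn_eqF//; exact: H1.
  have -> : rect A i0 B C `&` F `&` [set w | cell l (X i0 w) = c] =
      rect A' i0.+1 B C `&` E c.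
    rewrite recE; apply/seteqP; split => w /=.
      by move=> [[Hr Fw] Hc]; split => //; apply/(FE _ _ cl Hc).
    by move=> [[Hr Hc] Ew]; split => //; split => //; apply/(FE _ _ cl Hc).
  rewrite Ec mulrA; congr (_ * _); rewrite !pr_rect big_ord_recr/= /A' eqxx.
  rewrite [X in X * _ * _ = _](_ : _ = \prod_(i < i0) fine (mu (A i))).
    by rewrite mulrAC.
  by apply: eq_bigr => i _; rewrite ltn_eqF.
rewrite big_seq (eq_bigr _ term) -big_seq -mulr_sumr; congr (_ * _).
rewrite /cells big_cons big_map mu_cell_none//; congr (_ + _).
by rewrite big_seq [RHS]big_seq; apply: eq_bigr => s sl; rewrite mu_cell_some.
Qed.

Definition window (i0 a : nat) (s : S) (w : Omega) : nat :=
  (\sum_(i0 <= i < i0 + a) (s \in X i w))%N.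

Definition window_event (l : seq S) (i0 a : nat) (k : S -> nat) : set Omega :=
  [set w | forall s, s \in l -> window i0 a s w = k s].

Lemma windowS i0 a s w : window i0 a.+1 s w = ((s \in X i0 w) + window i0.+1 a s w)%N.
Proof. by rewrite /window addnS big_ltn ?ltnS ?leq_addr// addSn. Qed.

Lemma measurable_window i0 a s c : measurable [set w | window i0 a s w = c].
Proof.
have -> : [set w | window i0 a s w = c] =
    (fun w => \sum_(i0 <= i < i0 + a)
      \1_(X i @^-1` [set A : {fset S} | s \in A]) w : R) @^-1` [set c%:R].
  apply/seteqP; split => w /=.
    move=> <-; rewrite /window natr_sum; apply: eq_bigr => i _.
    rewrite indicE; case: (boolP (s \in X i w)) => h; first by rewrite mem_set.
    by rewrite memNset//; exact/negP.
  move=> E; apply/eqP; rewrite -(eqr_nat R) -E /window natr_sum; apply/eqP.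
  apply: eq_bigr => i _.
  rewrite indicE; case: (boolP (s \in X i w)) => h; first by rewrite mem_set.
  by rewrite memNset//; exact/negP.
have mf : measurable_fun setT (fun w => \sum_(i0 <= i < i0 + a)
    \1_(X i @^-1` [set A : {fset S} | s \in A]) w : R).
  by apply: measurable_sum => i; exact/measurable_indic/measurable_preX.
by rewrite -[X in measurable X]setTI; exact: mf.
Qed.

Lemma measurable_window_event l i0 a k : measurable (window_event l i0 a k).
Proof.
elim: l => [|s l IH].
  by rewrite (_ : window_event _ _ _ _ = setT)//; apply/seteqP; split.
rewrite (_ : window_event _ _ _ _ = [set w | window i0 a s w = k s] `&` window_event l i0 a k).
  by apply: measurableI => //; exact: measurable_window.
apply/seteqP; split => w.
  by move=> H; split; [apply: H; rewrite mem_head|move=> u ul; apply: H; rewrite inE ul orbT].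
by move=> [H1 H2] u; rewrite inE => /orP[/eqP ->//|/H2].
Qed.

(** The count of the window [i0, i0 + a) is peeled off from the left, and the
    multinomial weights satisfy the same recurrence.  F is the part of the event
    concerning draws after the window. *)
Lemma factors_window l a i0 k (F : set Omega) (q : R) : uniq l ->
  factors (i0 + a) F q ->
  factors i0 (window_event l i0 a k `&` F) (multinomial_weight l species_prob a k * q).
Proof.
move=> ul; elim: a i0 k => [|a IH] i0 k Fq.
  rewrite addn0 in Fq.
  have [mF _] := Fq.
  rewrite multinomial_weight0.
  have W0 s w : window i0 0 s w = 0%N by rewrite /window addn0 big_geq.
  have [/allP k0|nk0] := boolP (all _ _).
    rewrite mul1r (_ : window_event _ _ _ _ `&` F = F)//.
    apply/seteqP; split => w; first by case.
    by move=> Fw; split => // s /k0 /eqP ->.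
  rewrite mul0r (_ : window_event _ _ _ _ `&` F = set0); first exact: factors0.
  apply/seteqP; split => w // [H _]; move/negP: nk0; apply; apply/allP => s sl.
  by rewrite -(H s sl) W0.
have [mF _] := Fq.
rewrite addnS -addSn in Fq.
pose E (c : option (option S)) : set Omega := match c with
  | Some (Some s) => if (0 < k s)%N then window_event l i0.+1 a (decr k s) `&` F else set0
  | _ => window_event l i0.+1 a k `&` F end.
pose qc (c : option (option S)) : R := match c with
  | Some (Some s) => (if (0 < k s)%N then multinomial_weight l species_prob a (decr k s) else 0) * q
  | _ => multinomial_weight l species_prob a k * q end.
have -> : multinomial_weight l species_prob a.+1 k * q =
    (1 - \sum_(s <- l) species_prob s) * qc (Some None) +
    \sum_(s <- l) species_prob s * qc (Some (Some s)).
  rewrite multinomial_weightS// mulrDl -mulrA mulr_suml; congr (_ + _).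
  by apply: eq_bigr => s _; rewrite mulrA.
apply: (factors_peel (E := E) ul).
- by apply: measurableI => //; exact: measurable_window_event.
- move=> [[s|]|] cl; last by move: cl; rewrite /cells inE/= => /mapP[].
    rewrite /E /qc; case: ifPn => ks; first exact: IH.
    by rewrite mul0r; exact: factors0.
  exact: IH.
- move=> w [[s|]|] cl; last by move: cl; rewrite /cells inE/= => /mapP[].
    move=> /(cell_someP ul)[sl sX]; rewrite /E; case: ifPn => ks.
      split => -[H Fw]; split => // u ul'.
        have := H u ul'; rewrite windowS sX// /decr => <-.
        by rewrite addnC addnK.
      rewrite windowS sX// (H u ul') /decr.
      by case: eqVneq => [->|_]; rewrite ?subn0// add1n subn1 prednK.
    split => // -[H _]; have := H s sl; rewrite windowS sX// eqxx => kE.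
    by move: ks; rewrite -kE.
  move=> /cell_noneP sX; rewrite /E; split => -[H Fw]; split => // u ul'.
    by have := H u ul'; rewrite windowS sX.
  by rewrite windowS sX// H.
Qed.

Definition joint_event (l : seq S) (k k' : S -> nat) : set Omega :=
  [set w | forall s, s \in l ->
     first_count X n s w = k s /\ second_count X n m s w = k' s].

Let joint_eventE l k k' a b :
  joint_event l k k' `&` [set w | n w = a] `&` [set w | m w = b] =
  rect (fun=> setT) 0 [set a] [set b] `&`
    (window_event l 0 a k `&` (window_event l (0 + a) b k' `&` setT)).
Proof.
apply/seteqP; split => w /=.
  move=> [[H na] mb]; split; first by split => // i.
  split; first by move=> s /H[]; rewrite /first_count na.
  by split => // s /H[_]; rewrite /second_count na mb.
move=> [[_ [/= na mb]] [H1 [H2 _]]]; split => //; split => // s sl; split.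
  by rewrite -(H1 s sl) /first_count na.
by rewrite -(H2 s sl) /second_count na mb.
Qed.

Lemma measurable_joint_event l k k' : measurable (joint_event l k k').
Proof.
have -> : joint_event l k k' = \bigcup_a \bigcup_b
    (joint_event l k k' `&` [set w | n w = a] `&` [set w | m w = b]).
  apply/seteqP; split => w.
    by move=> H; exists (n w) => //; exists (m w) => //; split.
  by move=> [a _ [b _ [[]]]].
apply: bigcup_measurable => a _; apply: bigcup_measurable => b _.
rewrite joint_eventE; apply: measurableI; first exact: measurable_rect.
by apply: measurableI; [|apply: measurableI => //]; exact: measurable_window_event.
Qed.

Definition poisson_weight (x : R) (j : nat) : R := x ^+ j / j`!%:R * expR (- x).

(** Given n = a and m = b the two windows are adjacent, [0, a) and [a, a + b), so both
    multinomial weights factor out; the double sum over a and b is a product of two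
    Poisson mixtures. *)
Lemma counts_law l k k' : uniq l ->
  pr (joint_event l k k') = \prod_(s <- l)
    (poisson_weight (t * species_prob s) (k s) *
     poisson_weight (t' * species_prob s) (k' s)).
Proof.
move=> ul; pose E := joint_event l k k'.
have mE : measurable E by exact: measurable_joint_event.
have mn a : measurable [set w | n w = a] by exact: (measurable_preN n [set a]).
have mm a : measurable [set w | m w = a] by exact: (measurable_preN m [set a]).
pose q := multinomial_weight l species_prob.
have pn a : pr (n @^-1` [set a]) = poisson_pmf t a.
  by have := ps_law_n sampling a; rewrite /distribution /pushforward => ->.
have pm a : pr (m @^-1` [set a]) = poisson_pmf t' a.
  by have := ps_law_m sampling a; rewrite /distribution /pushforward => ->.
have Eab a b : pr (E `&` [set w | n w = a] `&` [set w | m w = b]) =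
    (poisson_pmf t a * q a k) * (poisson_pmf t' b * q b k').
  rewrite joint_eventE.
  have F2 : factors (0 + a) (window_event l (0 + a) b k' `&` setT) (q b k' * 1).
    by apply: factors_window => //; exact: factorsT.
  have [_ ->] := factors_window k ul F2.
  by rewrite pr_rect big_ord0 mul1r pn pm mulr1 -/q mulrACA.
have Ea a : pr (E `&` [set w | n w = a]) = poisson_pmf t a * q a k *
    \prod_(s <- l) poisson_weight (t' * species_prob s) (k' s).
  have c1 := @fine_measure_series _ _ _ P _ _ (measurableI _ _ mE (mn a)) mm.
  have c2 : \sum_(b < N) pr (E `&` [set w | n w = a] `&` [set w | m w = b])
      @[N --> \oo] --> poisson_pmf t a * q a k *
      \prod_(s <- l) poisson_weight (t' * species_prob s) (k' s).
    rewrite [X in X @ _](_ : _ = (fun N => poisson_pmf t a * q a k *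
        \sum_(b < N) poisson_pmf t' b * q b k')); last first.
      by apply/funext => N; rewrite mulr_sumr; apply: eq_bigr => b _; exact: Eab.
    by apply: cvgM; [exact: cvg_cst|exact: poisson_mixture_weight].
  exact: (cvg_unique _ c1 c2).
have c1 := @fine_measure_series _ _ _ P _ _ mE mn.
have c2 : \sum_(a < N) pr (E `&` [set w | n w = a]) @[N --> \oo] -->
    \prod_(s <- l) poisson_weight (t * species_prob s) (k s) *
    \prod_(s <- l) poisson_weight (t' * species_prob s) (k' s).
  rewrite [X in X @ _](_ : _ = (fun N => (\sum_(a < N) poisson_pmf t a * q a k) *
      \prod_(s <- l) poisson_weight (t' * species_prob s) (k' s))); last first.
    by apply/funext => N; rewrite mulr_suml; apply: eq_bigr => a _; exact: Ea.
  by apply: cvgM; [exact: poisson_mixture_weight|exact: cvg_cst].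
by rewrite big_split/=; exact: (cvg_unique _ c1 c2).
Qed.

Section functions_of_counts.
Variable phi : nat -> nat -> R.

Definition count_term (s : S) (w : Omega) : R :=
  phi (first_count X n s w) (second_count X n m s w).

Definition count_pair (s : S) (w : Omega) : nat * nat :=
  (first_count X n s w, second_count X n m s w).

(** The counts of the other species are kept as a list: lists of pairs form a
    countable type, so every event on them is generated by points. *)
Lemma measurable_count_pairs l (v : seq (nat * nat)) :
  measurable [set w | [seq count_pair u w | u <- l] = v].
Proof.
elim: l v => [|s l IH] [|y v].
- by rewrite (_ : [set _ | _] = setT)//; apply/seteqP; split.
- by rewrite (_ : [set _ | _] = set0)//; apply/seteqP; split.
- by rewrite (_ : [set _ | _] = set0)//; apply/seteqP; split.
rewrite (_ : [set _ | _] = joint_event [:: s] (fun=> y.1) (fun=> y.2) `&`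
    [set w | [seq count_pair u w | u <- l] = v]).
  by apply: measurableI => //; exact: measurable_joint_event.
apply/seteqP; split => w /=.
  move=> [ys vl]; split => // u; rewrite inE => /eqP ->.
  by case: y ys => y1 y2 [-> ->].
move=> [/(_ s (mem_head _ _)) [e1 e2] ->].
by rewrite /count_pair e1 e2; case: (y).
Qed.

Let indep_points l s (y : nat * nat) (v : seq (nat * nat)) : uniq l -> s \notin l ->
  pr ([set w | count_pair s w = y] `&` [set w | [seq count_pair u w | u <- l] = v]) =
  pr [set w | count_pair s w = y] * pr [set w | [seq count_pair u w | u <- l] = v].
Proof.
move=> ul sl; have [vl|vl] := eqVneq (size v) (size l); last first.
  have -> : [set w | [seq count_pair u w | u <- l] = v] = set0.
    apply/seteqP; split => w //= E; move: vl.
    by rewrite -E size_map eqxx.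
  by rewrite setI0 measure0 mulr0.
pose k u := if u == s then y.1 else (nth (0, 0)%N v (index u l)).1.
pose k' u := if u == s then y.2 else (nth (0, 0)%N v (index u l)).2.
have Es : [set w | count_pair s w = y] = joint_event [:: s] k k'.
  apply/seteqP; split => w /=.
    by move=> E u; rewrite inE => /eqP ->; rewrite /k /k' eqxx -E.
  move=> /(_ s (mem_head _ _)) []; rewrite /k /k' eqxx /count_pair => -> ->.
  by case: (y).
have El : [set w | [seq count_pair u w | u <- l] = v] = joint_event l k k'.
  have us u : u \in l -> (u == s) = false.
    by move=> ul'; apply/negbTE; apply: contraNneq sl => <-.
  apply/seteqP; split => w /=.
    move=> E u ul'; rewrite /k /k' us// -E (nth_map u) ?index_mem// nth_index//.
  move=> H; apply: (@eq_from_nth _ (0, 0)%N); first by rewrite size_map vl.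
  move=> i; rewrite size_map => il.
  have [|H1 H2] := H (nth s l i); first exact: mem_nth.
  rewrite (nth_map s)// /count_pair H1 H2 /k /k' us ?mem_nth// index_uniq//.
  by case: nth.
rewrite Es El.
have -> : joint_event [:: s] k k' `&` joint_event l k k' = joint_event (s :: l) k k'.
  apply/seteqP; split => w.
    by move=> [H1 H2] u; rewrite inE => /orP[us|/H2//]; apply: H1; rewrite inE.
  by move=> H; split => u ul'; apply: H; rewrite inE ?ul' ?orbT//; move: ul'; rewrite inE => ->.
rewrite !counts_law//; last by rewrite /= sl.
by rewrite big_cons big_seq1.
Qed.

Lemma measurable_count_pair s (y : nat * nat) : measurable [set w | count_pair s w = y].
Proof.
have := measurable_count_pairs [:: s] [:: y].
rewrite (_ : [set w | _] = [set w | count_pair s w = y])//.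
by apply/seteqP; split => w /=; [case|move=> ->].
Qed.

Lemma measurable_count_term s : measurable_fun setT (count_term s).
Proof.
move=> _ B mB; rewrite setTI.
exact: (measurable_countable_preimage (measurable_count_pair s)
  [set y | B (phi y.1 y.2)]).
Qed.

(** By [counts_law] the point probabilities multiply; these identities extend to all
    events first in the list of other counts, then in the count of s. *)
Lemma loo_indep_count_term : loo_indep P count_term.
Proof.
move=> l s ul sl A B mA mB.
pose l' := [seq u <- l | u != s].
have ul' : uniq l' by exact: filter_uniq.
have sl' : s \notin l' by rewrite mem_filter eqxx.
pose V w := [seq count_pair u w | u <- l'].
pose A' := [set y : nat * nat | A (phi y.1 y.2)].
pose B' := [set v : seq (nat * nat) | B (\sum_(y <- v) phi y.1 y.2)].
have mV := measurable_count_pairs l'.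
have mY := measurable_count_pair s.
have -> : count_term s @^-1` A = count_pair s @^-1` A' by [].
have -> : (fun w => \sum_(u <- l | u != s) count_term u w) @^-1` B = V @^-1` B'.
  by apply/seteqP; split => w /=; rewrite /B' /V /= big_map big_filter.
have mA' := measurable_countable_preimage mY A'.
have mB' := measurable_countable_preimage mV B'.
have e1 y : pr ([set w | count_pair s w = y] `&` (V @^-1` B')) =
    pr [set w | count_pair s w = y] * pr (V @^-1` B').
  rewrite setIC mulrC; apply: (fine_measure_countable_ext mV (mY y)) => v.
  by rewrite setIC mulrC; exact: indep_points.
have e2 := fine_measure_countable_ext mY mB' e1 A'.
rewrite -[LHS]fineK ?fin_num_measure//; last exact: measurableI.
by rewrite e2 EFinM !fineK ?fin_num_measure.
Qed.

End functions_of_counts.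

(** * Sums over all species *)

Section species_sums.
Variables (phi : nat -> nat -> R) (M : R).
Hypothesis phi00 : phi 0%N 0%N = 0.
Hypothesis phi_le : forall a b, `|phi a b| <= M.

Definition species_sum (w : Omega) : R :=
  \sum_(s \in [set: S]) count_term phi s w.

(** Only the species in the n + m observed finite sets have nonzero counts. *)
Lemma unseen_species w : exists K0, forall K s, (K0 <= K)%N ->
  s \notin enum_upto S K -> first_count X n s w = 0%N /\ second_count X n m s w = 0%N.
Proof.
pose N := (n w + m w)%N.
pose top (i : nat) := (\max_(s <- enum_fset (X i w)) (choice.pickle s).+1)%N.
exists (\max_(i < N) top i)%N => K s K0K.
rewrite mem_enum_upto -leqNgt => Ks.
have sX i : (i < N)%N -> (s \in X i w) = false.
  move=> iN; apply/negbTE/negP => sXi.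
  have : (choice.pickle s < K)%N.
    have h1 : ((choice.pickle s).+1 <= top i)%N by exact: leq_bigmax_seq.
    apply: (leq_trans h1); apply: leq_trans K0K.
    exact: (@leq_bigmax _ (fun i : 'I_N => top i) (Ordinal iN)).
  by rewrite ltnNge Ks.
split; rewrite /first_count /second_count big_nat big1// => i /andP[ni im].
  by rewrite sX// (leq_trans im)// leq_addr.
by rewrite sX.
Qed.

Lemma species_sumE w : exists K0, forall K, (K0 <= K)%N ->
  species_sum w = \sum_(s <- enum_upto S K) count_term phi s w.
Proof.
have [K0 HK] := unseen_species w; exists K0 => K K0K.
apply: fsbig_enum_upto => s sK.
by have [e1 e2] := HK K s K0K sK; rewrite /count_term e1 e2.
Qed.

Lemma cvg_species_sum w :
  \sum_(s <- enum_upto S K) count_term phi s w @[K --> \oo] --> species_sum w.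
Proof.
have [K0 HK] := species_sumE w.
by apply: cvg_near_cst; exists K0 => // K /= K0K; rewrite -HK.
Qed.

(** Each of the n + m draws contributes to the counts of at most one species. *)
Lemma count_sum_le l w : uniq l -> (forall i, (#|` X i w| <= 1)%N) ->
  `|\sum_(s <- l) count_term phi s w| <= M * (n w + m w)%:R.
Proof.
move=> ul X1; have M0 : 0 <= M by exact: le_trans (normr_ge0 _) (phi_le 0 0).
rewrite (le_trans (ler_norm_sum _ _ _))//.
apply: (@le_trans _ _ (\sum_(s <- l) M * (first_count X n s w + second_count X n m s w)%:R)).
  apply: ler_sum => s _; rewrite /count_term.
  case: (first_count X n s w) (second_count X n m s w) => [|a] [|b].
  - by rewrite phi00 normr0 mulr0.
  - by rewrite (le_trans (phi_le _ _))// ler_peMr// ler1n.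
  - by rewrite (le_trans (phi_le _ _))// ler_peMr// ler1n addn0.
  - by rewrite (le_trans (phi_le _ _))// ler_peMr// ler1n.
rewrite -mulr_sumr ler_wpM2l// -natr_sum ler_nat.
have -> : (\sum_(s <- l) (first_count X n s w + second_count X n m s w) =
    \sum_(0 <= i < n w + m w) \sum_(s <- l) (s \in X i w))%N.
  rewrite exchange_big/=; apply: eq_bigr => s _.
  by rewrite /first_count /second_count -big_cat_nat// leq_addr.
apply: (@leq_trans (\sum_(0 <= i < n w + m w) 1)%N).
  apply: leq_sum => i _; rewrite -[leqLHS]big_mkcond sum1_count -size_filter.
  apply: leq_trans (X1 i); apply: uniq_leq_size; first exact: filter_uniq.
  by move=> s; rewrite mem_filter => /andP[].
by rewrite sum_nat_const_nat muln1 subn0.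
Qed.

Lemma ae_at_most_one : {ae P, forall w, forall i, (#|` X i w| <= 1)%N}.
Proof.
have : P.-negligible (\bigcup_i (X i @^-1` [set A : {fset S} | (1 < #|` A|)%N])).
  apply: negligible_bigcup => i; apply/negligibleP; first exact: measurable_preX.
  by have := ps_law_X sampling i [set A : {fset S} | (1 < #|` A|)%N]; rewrite mu_many.
apply: negligibleS => w /= /existsNP[i Xi]; exists i => //=.
by rewrite ltnNge; apply/negP.
Qed.

(* The dominating function, with finite second moment. *)
Let Y w : R := M * (n w + m w)%:R.

Let iN2 : P.-integrable setT (EFin \o (fun w => (n w + m w)%:R ^+ 2)).
Proof.
have i1 := integrable_square_poisson t_gt0 (ps_law_n sampling).
have i2 := integrable_square_poisson t'_gt0 (ps_law_m sampling).
have i3 := integrable_addr (integrable_mulr 2 i1) (integrable_mulr 2 i2).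
apply: (le_integrable _ _ _ i3) => //.
  apply/measurable_EFinP; apply: measurable_funX.
  under eq_fun do rewrite natrD.
  by apply: measurable_funD; exact: measurable_natr_RV.
move=> w _ /=; rewrite lee_fin natrD !ger0_norm ?sqr_ge0//.
  by have := sqr_ge0 ((n w)%:R - (m w)%:R : R); rewrite !expr2; lra.
Qed.

Let iY2 : P.-integrable setT (EFin \o (fun w => Y w ^+ 2)).
Proof.
have := integrable_mulr (M ^+ 2) iN2; apply: eq_integrable => // w _.
by rewrite /= exprMn.
Qed.

Let iY : P.-integrable setT (EFin \o Y).
Proof.
have mY : measurable_fun setT Y.
  apply: measurable_funM => //; under eq_fun do rewrite natrD.
  by apply: measurable_funD; exact: measurable_natr_RV.
have i1 : P.-integrable setT (EFin \o (fun=> 1 : R)) by exact: finite_measure_integrable_cst.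
apply: (le_integrable _ _ _ (integrable_addr i1 iY2)) => //.
  exact/measurable_EFinP.
move=> w _ /=; rewrite lee_fin [leRHS]ger0_norm; last by rewrite addr_ge0// sqr_ge0.
rewrite -(real_normK (num_real (Y w))); have := sqr_ge0 (`|Y w| - 1).
by have := sqr_ge0 (`|Y w|); move: `|Y w| => y; rewrite !expr2; lra.
Qed.

Let dom : {ae P, forall w, forall K,
  `|\sum_(s <- enum_upto S K) count_term phi s w| <= Y w}.
Proof.
move: ae_at_most_one; apply: filterS => w X1 K.
by apply: count_sum_le => //; exact: enum_upto_uniq.
Qed.

Let bZ s w : `|count_term phi s w| <= M. Proof. exact: phi_le. Qed.

Lemma species_sum_mean : [/\ measurable_fun setT species_sum,
  P.-integrable setT (EFin \o species_sum) &
  \sum_(s <- enum_upto S K) \int[P]_w count_term phi s w @[K --> \oo] -->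
    \int[P]_w species_sum w].
Proof.
exact: (series_mean_cvg (measurable_count_term phi) bZ cvg_species_sum iY dom).
Qed.

Let ED := \int[P]_w species_sum w.

Lemma species_sum_variance :
  P.-integrable setT (EFin \o (fun w => (species_sum w - ED) ^+ 2)) /\
  \sum_(s <- enum_upto S K)
    \int[P]_w (count_term phi s w - \int[P]_w count_term phi s w) ^+ 2 @[K --> \oo] -->
    \int[P]_w (species_sum w - ED) ^+ 2.
Proof.
exact: (series_variance_cvg (measurable_count_term phi) bZ
  (loo_indep_count_term phi) (@enum_upto_uniq S) cvg_species_sum iY iY2 dom).
Qed.

Section normalized_species_sum.
Variable sigma : R.
Hypothesis sigma_gt0 : 0 < sigma.
Hypothesis sigmaE : sigma ^+ 2 = \int[P]_w (species_sum w - ED) ^+ 2.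

Lemma species_sum_unit_second_moment :
  unit_second_moment P (fun w => (species_sum w - ED) / sigma).
Proof.
exact: (series_unit_second_moment (measurable_count_term phi) bZ
  (loo_indep_count_term phi) (@enum_upto_uniq S) cvg_species_sum iY iY2 dom
  sigma_gt0 sigmaE).
Qed.

Lemma species_sum_stein_bound :
  stein_bound P (fun w => (species_sum w - ED) / sigma) (2 * M / sigma).
Proof.
exact: (series_stein_bound (measurable_count_term phi) bZ
  (loo_indep_count_term phi) (@enum_upto_uniq S) cvg_species_sum iY iY2 dom
  sigma_gt0 sigmaE).
Qed.

End normalized_species_sum.
End species_sums.

(** * Prediction error and variance estimator *)

Section prediction.
Variables (H : nat -> R) (h : R).
Hypothesis H0 : H 0%N = 0.
Hypothesis H_le : forall i, `|H i| <= h.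

Let z a b : R := ((a == 0)%N && (0 < b)%N)%:R - H a.
Let u a (_ : nat) : R := H a + H a ^+ 2.
Let e1 a (_ : nat) : R := H a.
Let e2 a (_ : nat) : R := H a ^+ 2.

Let h0 : 0 <= h. Proof. exact: le_trans (normr_ge0 _) (H_le 0). Qed.
Let z0 : z 0 0 = 0. Proof. by rewrite /z H0 ltnn andbF subr0. Qed.
Let u0 : u 0 0 = 0. Proof. by rewrite /u H0 expr0n addr0. Qed.
Let e20 : e2 0 0 = 0. Proof. by rewrite /e2 H0 expr0n. Qed.

Let z_le a b : `|z a b| <= 1 + h.
Proof. by rewrite (le_trans (ler_normB _ _))// lerD// ger0_norm// lern1 leq_b1. Qed.
Let e2_le a b : `|e2 a b| <= h ^+ 2.
Proof. by rewrite normrX lerXn2r// nnegrE. Qed.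
Let u_le a b : `|u a b| <= h + h ^+ 2.
Proof. by rewrite (le_trans (ler_normD _ _))// lerD// e2_le. Qed.

(* H 0 = 0 kills the product of the indicator and H. *)
Let z_sqr a b : z a b ^+ 2 = z a b + u a b.
Proof.
rewrite /z /u; case: a => [|a]/=; last by rewrite sub0r; ring.
by rewrite H0; case: (0 < b)%N => /=; ring.
Qed.

(** The species seen only by the second expedition are those with N_s = 0 < N'_s. *)
Lemma prediction_errorE : prediction_error X n m H = species_sum z.
Proof.
apply/funext => w; have [K0 HK] := unseen_species w.
have unseen s := HK K0 s (leqnn K0).
have eK (f : S -> R) : (forall s, s \notin enum_upto S K0 -> f s = 0) ->
    \sum_(s \in [set: S]) f s = \sum_(s <- enum_upto S K0) f s.
  exact: fsbig_enum_upto.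
rewrite /prediction_error /newly_seen /seen_total /seen_first /linear_estimator.
rewrite /species_sum !eK; last 2 first.
- by move=> s /unseen[e e']; rewrite /count_term e e'.
- by move=> s /unseen[e _]; rewrite e.
rewrite !(@card_fset_set_enum_upto _ _ K0); last 2 first.
- by move=> s /=; apply: contraTT => /unseen[-> _].
- by move=> s /=; apply: contraTT => /unseen[-> ->].
rewrite !natr_sum -!sumrB; apply: eq_bigr => s _; rewrite /count_term /z.
have mE (p : S -> bool) : (s \in [set v | p v]) = p s by apply/idP/idP; rewrite inE.
rewrite (mE (fun v => 0 < first_count X n v w + second_count X n m v w)%N).
rewrite (mE (fun v => 0 < first_count X n v w)%N).
by case: (first_count X n s w) => [|a]; rewrite /= ?subr0// subrr.
Qed.

Lemma variance_estimatorE : variance_estimator X n H = species_sum u.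
Proof.
apply/funext => w; have [K0 HK] := unseen_species w.
have unseen s := HK K0 s (leqnn K0).
have eK (f : S -> R) : (forall s, s \notin enum_upto S K0 -> f s = 0) ->
    \sum_(s \in [set: S]) f s = \sum_(s <- enum_upto S K0) f s.
  exact: fsbig_enum_upto.
rewrite /variance_estimator /linear_estimator /species_sum !eK.
- by rewrite -big_split.
all: by move=> s /unseen[e _]; rewrite /count_term e ?u0 ?H0 ?expr0n.
Qed.

Let D := prediction_error X n m H.
Let U := variance_estimator X n H.
Let B := \int[P]_w D w.
Let V := \int[P]_w (D w - B) ^+ 2.
Let EU := \int[P]_w U w.
Let VU := \int[P]_w (U w - EU) ^+ 2.
Let E1 := \int[P]_w linear_estimator X n H w.
Let E2 := \int[P]_w species_sum e2 w.
Let b s := \int[P]_w count_term z s w.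

Let mean_z : [/\ measurable_fun setT D, P.-integrable setT (EFin \o D) &
  \sum_(s <- enum_upto S K) b s @[K --> \oo] --> B].
Proof. by rewrite /B /D prediction_errorE; exact: species_sum_mean z0 z_le. Qed.

Let mean_u : [/\ measurable_fun setT U, P.-integrable setT (EFin \o U) &
  \sum_(s <- enum_upto S K) \int[P]_w count_term u s w @[K --> \oo] --> EU].
Proof. by rewrite /EU /U variance_estimatorE; exact: species_sum_mean u0 u_le. Qed.

Let mean_e1 := species_sum_mean (H0 : e1 0 0 = 0) (fun a _ => H_le a).
Let mean_e2 := species_sum_mean e20 e2_le.

Let i_term phi M s : (forall a b, `|phi a b| <= M) ->
  P.-integrable setT (EFin \o count_term phi s).
Proof.
move=> phiM; apply: (@bounded_integrable _ _ _ _ _ M) => [|w]; last exact: phiM.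
exact: measurable_count_term.
Qed.

Let EU_split : EU = E1 + E2.
Proof.
have [_ _ c] := mean_u; have [_ _ c1] := mean_e1; have [_ _ c2] := mean_e2.
suff e : (fun K => \sum_(s <- enum_upto S K) \int[P]_w count_term u s w) =
    (fun K => \sum_(s <- enum_upto S K) \int[P]_w count_term e1 s w +
      \sum_(s <- enum_upto S K) \int[P]_w count_term e2 s w).
  by rewrite e in c; exact: (cvg_unique _ c (cvgD c1 c2)).
apply/funext => K; rewrite -big_split; apply: eq_bigr => s _ /=.
by rewrite -RintegralD//; [exact: (i_term _ (fun a _ => H_le a))|exact: (i_term _ e2_le)].
Qed.

(* Var(Z_s) = E[Z_s^2] - b_s^2 = b_s + E[u_s] - b_s^2, summed over the species. *)
Let sq_cvg : \sum_(s <- enum_upto S K) b s ^+ 2 @[K --> \oo] --> B + EU - V.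
Proof.
have [_ _ c1] := mean_z; have [_ _ c2] := mean_u.
have [_ c3] := species_sum_variance z0 z_le.
rewrite -prediction_errorE -/D -/B -/V in c3.
suff -> : (fun K => \sum_(s <- enum_upto S K) b s ^+ 2) =
    (fun K => \sum_(s <- enum_upto S K) b s +
      \sum_(s <- enum_upto S K) \int[P]_w count_term u s w -
      \sum_(s <- enum_upto S K) \int[P]_w (count_term z s w - b s) ^+ 2).
  exact: cvgB (cvgD c1 c2) c3.
apply/funext => K.
rewrite -big_split -sumrB; apply: eq_bigr => s _ /=.
rewrite (Rintegral_centered_sqr P (measurable_count_term z s) (fun w => z_le _ _)) -/(b s).
rewrite [X in _ - (X - _)](_ : _ = b s + \int[P]_w count_term u s w); first by ring.
rewrite -RintegralD//; [|exact: i_term z_le|exact: i_term u_le].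
by apply: eq_Rintegral => w _; exact: z_sqr.
Qed.

(* The terms |Z_s| are again functions of the counts vanishing at (0, 0), so their sum
   has a finite mean. *)
Let abs_sum_le : exists A, forall K, \sum_(s <- enum_upto S K) `|b s| <= A.
Proof.
pose az i j := `|z i j|.
have az0 : az 0%N 0%N = 0 by rewrite /az z0 normr0.
have az_le i j : `|az i j| <= 1 + h by rewrite normr_id.
have [_ _ c] := species_sum_mean az0 az_le.
exists (\int[P]_w species_sum az w) => K.
apply: (@le_trans _ _ (\sum_(s <- enum_upto S K) \int[P]_w count_term az s w)).
  by apply: ler_sum => s _; apply: le_normr_Rintegral => //; exact: i_term z_le.
rewrite -(cvg_lim (@Rhausdorff R) c); apply: nondecreasing_cvgn_le; last exact: cvgP c.
by apply: nondecreasing_enum_sum => s; apply: Rintegral_ge0 => w _; exact: normr_ge0.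
Qed.

Lemma species_biasE s : species_bias X n m H s = (b s)%:E.
Proof.
rewrite /species_bias unlock /b /Rintegral fineK//.
by apply: integrable_fin_num => //; exact: i_term z_le.
Qed.

Lemma signed_esum_bias : signed_esum (species_bias X n m H) = B%:E.
Proof.
have -> : species_bias X n m H = (fun s => (b s)%:E) by apply/funext => s; exact: species_biasE.
have [A bA] := abs_sum_le; have [_ _ c] := mean_z.
exact: signed_esum_enum_cvg c bA.
Qed.

Lemma esum_bias_sqr :
  (\esum_(s in [set: S]) species_bias X n m H s ^+ 2 = (B + EU - V)%:E)%E.
Proof.
rewrite -(esum_enum_cvg _ sq_cvg); last by move=> s; exact: sqr_ge0.
by apply: eq_esum => s _; rewrite species_biasE EFin_expe.
Qed.

Lemma variance_prediction_error : variance P D = V%:E.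
Proof.
have [i2 _] := species_sum_variance z0 z_le.
rewrite -prediction_errorE -/D -/B in i2.
rewrite /variance unlock unlock /V /Rintegral fineK; last first.
  by apply: integrable_fin_num => //; exact: i2.
by apply: eq_integral => w _.
Qed.

(** H + H^2 = (1 + H) H and |1 + H| <= 1 + h, term by term. *)
Lemma variance_of_variance_estimator : VU <= (1 + h) ^+ 2 * E2.
Proof.
have [_ c] := species_sum_variance u0 u_le.
rewrite -variance_estimatorE -/U -/EU -/VU in c.
have [_ _ c2] := mean_e2.
have c3 : (1 + h) ^+ 2 * (\sum_(s <- enum_upto S K) \int[P]_w count_term e2 s w)
    @[K --> \oo] --> (1 + h) ^+ 2 * E2.
  by apply: cvgM => //; exact: cvg_cst.
apply: (ler_cvg_to c c3); near=> K; rewrite mulr_sumr; apply: ler_sum => s _.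
rewrite (Rintegral_centered_sqr P (measurable_count_term u s) (fun w => u_le _ _)).
apply: (@le_trans _ _ (\int[P]_w count_term u s w ^+ 2)).
  by rewrite gerBl sqr_ge0.
rewrite -RintegralZl//; last exact: i_term e2_le.
apply: le_Rintegral => //.
- apply: (@bounded_integrable _ _ _ _ _ ((h + h ^+ 2) ^+ 2)).
    by apply: measurable_funX; exact: measurable_count_term.
  move=> w; rewrite normrX; apply: lerXn2r; last exact: u_le.
    by rewrite nnegrE.
  by rewrite nnegrE addr_ge0 ?sqr_ge0.
- by apply: integrable_mulr; exact: i_term e2_le.
move=> w _; rewrite /count_term /u /e2; set x := H _.
rewrite (_ : x + x ^+ 2 = (1 + x) * x); last by ring.
have x1 : `|1 + x| <= 1 + h.
  by rewrite (le_trans (ler_normD _ _))// normr1 lerD2l H_le.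
rewrite exprMn ler_wpM2r ?sqr_ge0// -(real_normK (num_real (1 + x))).
by apply: lerXn2r => //; rewrite nnegrE// addr_ge0.
Unshelve. all: by end_near. Qed.

Lemma sqr1D_le (a : R) : (1 + a) ^+ 2 <= 2 * (1 + a ^+ 2).
Proof. by have := sqr_ge0 (1 - a); rewrite !expr2; lra. Qed.

(** The numerator of the ratio dominates each of its nonnegative parts.  The sum of the
    squared biases is B + E[U] - V, so |E[U] - V| is at most that sum plus |B|.  A
    zero variance would make the ratio infinite. *)
Lemma clt_ratio_bounds delta : sup_norm H = h%:E -> 0 <= E1 ->
  (clt_ratio X n m H <= delta%:E)%E ->
  [/\ 0 < V, 1 + h ^+ 2 <= delta * V, `|EU - V| <= delta * V &
      VU <= (1 + h) ^+ 2 * EU].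
Proof.
move=> supH E10.
have Q0 : 0 <= B + EU - V.
  rewrite -lee_fin -esum_bias_sqr; apply: esum_ge0 => s _.
  by rewrite species_biasE -EFin_expe lee_fin sqr_ge0.
have V_ge0 : 0 <= V by apply: Rintegral_ge0 => w _; exact: sqr_ge0.
have E20 : 0 <= E2.
  apply: Rintegral_ge0 => w _; have [K0 HK] := species_sumE e20 w.
  by rewrite (HK K0)// sumr_ge0// => s _; exact: sqr_ge0.
rewrite /clt_ratio signed_esum_bias esum_bias_sqr supH variance_prediction_error.
rewrite -EFin_expe abse_EFin -!EFinD.
have [V0|V0] := eqVneq V 0.
  have num0 : 0 < `|B| + (B + EU - V) + h ^+ 2 + 1.
    by have := normr_ge0 B; have := sqr_ge0 h; lra.
  by rewrite V0 inve0 gt0_muley -?V0 ?lte_fin// leye_eq.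
have V_gt0 : 0 < V by rewrite lt0r V0.
rewrite inver (negbTE V0) -EFinM lee_fin ler_pdivrMr// => ratio.
have nB := normr_ge0 B; have h2 := sqr_ge0 h.
have BQ : `|B| + (B + EU - V) <= delta * V by lra.
split => //; first by lra.
  have := ler_norm B; have := ler_norm (- B); rewrite normrN => B1 B2.
  by rewrite ler_norml; apply/andP; split; lra.
apply: (le_trans variance_of_variance_estimator).
by rewrite ler_wpM2l ?sqr_ge0// EU_split lerDr.
Qed.

(** Chebyshev's inequality.  E[U] is within half of the tolerance kappa V of V; and
    Var(U) <= (1 + h)^2 E[U] <= 2 (delta V) (2 V), to be divided by
    (kappa V / 2)^2. *)
Lemma variance_estimator_close delta kappa : 0 < delta <= 1 -> delta <= kappa / 2 ->
  0 < V -> 1 + h ^+ 2 <= delta * V -> `|EU - V| <= delta * V ->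
  VU <= (1 + h) ^+ 2 * EU ->
  pr [set w | kappa <= `|U w / V - 1|] <= 16 * delta / kappa ^+ 2.
Proof.
move=> /andP[d0 d1] dk V_gt0 hV EUV VUle.
have k0 : 0 < kappa by lra.
have [mU _ _] := mean_u.
have [iU2 _] := species_sum_variance u0 u_le.
rewrite -variance_estimatorE -/U -/EU in iU2.
pose a := (kappa / 2 * V) ^+ 2.
have a0 : 0 < a by rewrite exprn_gt0// mulr_gt0// divr_gt0.
have mU2 : measurable_fun setT (fun w => (U w - EU) ^+ 2).
  by apply: measurable_funX; exact: measurable_funB.
have VU2 : VU <= 4 * delta * V ^+ 2.
  apply: (le_trans VUle); apply: (@le_trans _ _ (2 * (delta * V) * (2 * V))).
    have EU0 : 0 <= EU by move: EUV; rewrite ler_norml => /andP[? _]; nra.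
    apply: ler_pM => //; first exact: sqr_ge0.
      by rewrite (le_trans (sqr1D_le h))// ler_wpM2l.
    by move: EUV; rewrite ler_norml => /andP[_ ?]; nra.
  by rewrite le_eqVlt; apply/orP; left; apply/eqP; ring.
have sub : [set w | kappa <= `|U w / V - 1|] `<=` [set w | a <= (U w - EU) ^+ 2].
  move=> w /= kw; rewrite /a -(real_normK (num_real (U w - EU))).
  have kV : kappa * V <= `|U w - V|.
    have -> : U w - V = (U w / V - 1) * V by rewrite mulrBl divfK ?gt_eqF// mul1r.
    by rewrite normrM (gtr0_norm V_gt0) ler_wpM2r// ltW.
  have tri : `|U w - V| <= `|U w - EU| + `|EU - V|.
    by rewrite (_ : U w - V = (U w - EU) + (EU - V)) ?ler_normD//; ring.
  apply: lerXn2r; rewrite ?nnegrE ?normr_ge0//; first by rewrite mulr_ge0 ?divr_ge0 ?ltW.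
  have dkV : delta * V <= kappa / 2 * V by rewrite ler_wpM2r// ltW.
  by move: kV tri EUV dkV; lra.
have mset1 : measurable [set w | kappa <= `|U w / V - 1|].
  apply: measurable_superlevel; apply: measurableT_comp => //.
  by apply: measurable_funB => //; exact: measurable_funM.
have mset2 : measurable [set w | a <= (U w - EU) ^+ 2].
  exact: measurable_superlevel.
have le1 := @fine_measure_le _ _ _ P _ _ mset1 mset2 sub.
have le2 := markov_fine mU2 iU2 (fun w => sqr_ge0 (U w - EU)) a0.
apply: (le_trans (le_trans le1 le2)).
rewrite ler_pdivrMr// (le_trans VU2)// /a le_eqVlt; apply/orP; left; apply/eqP.
by field; rewrite gt_eqF.
Qed.

(** The error normalized by the true standard deviation has terms of size at most
    2 (1 + h) / sqrt V, whose square is at most 8 (1 + h^2) / V <= 8 delta; it serves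
    as W, and the variance estimator replaces V at the cost e. *)
Lemma studentized_error_cdf_close c x kappa delta delta' e : sup_norm H = h%:E ->
  0 <= E1 -> (clt_ratio X n m H <= delta%:E)%E ->
  0 < delta <= 1 -> 0 < kappa < 1 -> delta <= kappa / 2 ->
  16 * delta / kappa ^+ 2 <= e -> 0 < delta' -> 8 * delta <= delta' ^+ 2 ->
  measurable (studentized_error X n m H c @^-1` `]-oo, x]) /\
  exists W : Omega -> R, [/\ unit_second_moment P W, stein_bound P W delta' &
    pr (W @^-1` `]-oo, x - `|x| * kappa]) - e <=
      pr (studentized_error X n m H c @^-1` `]-oo, x]) <=
    pr (W @^-1` `]-oo, x + `|x| * kappa]) + e].
Proof.
move=> supH E10 ratio d01 k01 dk de d'0 dd'.
have [V_gt0 hV EUV VUle] := clt_ratio_bounds supH E10 ratio.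
pose sigma := Num.sqrt V.
have s0 : 0 < sigma by rewrite sqrtr_gt0.
have sV : sigma ^+ 2 = V by rewrite sqr_sqrtr// ltW.
have sE : sigma ^+ 2 = \int[P]_w (species_sum z w - \int[P]_w species_sum z w) ^+ 2.
  by rewrite sV /V /B /D prediction_errorE.
have [mD _ _] := mean_z; have [mU _ _] := mean_u.
have -> : studentized_error X n m H c =
  (fun w => if 0 < U w then (D w - B) / Num.sqrt (U w) else c).
  by apply/funext => w; rewrite /studentized_error unlock.
split; first exact: measurable_studentized_le.
exists (fun w => (D w - B) / sigma); split.
- by rewrite /B /D prediction_errorE; exact: species_sum_unit_second_moment z0 z_le _ s0 sE.
- have : stein_bound P (fun w => (D w - B) / sigma) (2 * (1 + h) / sigma).
    by rewrite /B /D prediction_errorE; exact: species_sum_stein_bound z0 z_le _ s0 sE.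
  apply: stein_bound_le; rewrite ler_pdivrMr//.
  have h1 : 0 <= 2 * (1 + h) by rewrite mulr_ge0// addr_ge0.
  have d's : 0 <= delta' * sigma by rewrite mulr_ge0// ltW.
  rewrite -(ler_sqr (h1 : _ \is Num.nneg) (d's : _ \is Num.nneg)) !exprMn sV.
  have := sqr1D_le h; have : 8 * delta * V <= delta' ^+ 2 * V by rewrite ler_wpM2r// ltW.
  by move: hV; rewrite -[2 ^+ 2]/(2 * 2 : R); lra.
have close : pr [set w | kappa <= `|U w / sigma ^+ 2 - 1|] <= e.
  by rewrite sV; apply: (le_trans (variance_estimator_close d01 dk V_gt0 hV EUV VUle)).
exact: (@studentized_cdf _ _ _ P D U sigma B c x kappa e mD mU s0 k01 close).
Qed.

End prediction.
End poisson_splitting.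

(** * Convergence in distribution *)

Lemma gauss_cdf_shift (R : realType) (x y a : R) : `|y - x| <= a ->
  `|gauss_cdf y - gauss_cdf x| <= normal_peak 1 * a.
Proof.
have p0 : 0 <= normal_peak (1 : R) by exact: normal_peak_ge0.
have aux (u v : R) : u <= v -> `|gauss_cdf v - gauss_cdf u| <= normal_peak 1 * (v - u).
  move=> uv; have /andP[l1 l2] := gauss_cdf_lipschitz uv.
  by rewrite ger0_norm ?subr_ge0// lerBlDl.
have [xy|/ltW yx] := leP x y.
  rewrite (ger0_norm (_ : 0 <= y - x)) ?subr_ge0// => ya.
  by rewrite (le_trans (aux _ _ xy))// ler_wpM2l.
rewrite distrC (ger0_norm (_ : 0 <= x - y)) ?subr_ge0// => ya.
by rewrite distrC (le_trans (aux _ _ yx))// ler_wpM2l.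
Qed.

(** The estimate at a fixed time.  The tolerance eps is spent in three equal parts: on
    the normal approximation at the shifted threshold, on the shift by |x| kappa,
    and on the bad event of the variance estimator. *)
Lemma studentized_error_cdf_near (R : realType) (x eps : R) : 0 < eps ->
  exists2 delta : R, 0 < delta & forall (S : countType)
    (mu : probability {fset S} R) (t t' : R) (d : measure_display)
    (Omega : measurableType d) (P : probability Omega R)
    (X : nat -> {RV P >-> {fset S}}) (n m : {RV P >-> nat}) (H : nat -> R) (c : R),
    0 < t -> 0 < t' -> poisson_sampling mu t t' X n m -> at_most_one_species mu ->
    H 0%N = 0 -> (sup_norm H < +oo)%E ->
    (0 <= 'E_P[linear_estimator X n H])%E ->
    (clt_ratio X n m H <= delta%:E)%E ->
    measurable (studentized_error X n m H c @^-1` `]-oo, x]) /\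
    `|fine (P (studentized_error X n m H c @^-1` `]-oo, x])) - gauss_cdf x| <= eps.
Proof.
move=> eps0; pose e := eps / 3.
have e0 : 0 < e by rewrite divr_gt0.
pose p : R := normal_peak 1; have p0 : 0 <= p by exact: normal_peak_ge0.
(* q only has to dominate p |x| and be positive, so that kappa <= e / q makes the
   Gaussian distribution function move by at most e. *)
pose q := (p + 1) * (`|x| + 1).
have q0 : 0 < q by rewrite mulr_gt0// ltr_wpDl.
pose kappa := Num.min (1 / 2) (e / q).
have k0 : 0 < kappa by rewrite lt_min !divr_gt0.
have [k12 kq] : kappa <= 1 / 2 /\ kappa <= e / q by split; rewrite ge_min lexx ?orbT.
have pk : p * (`|x| * kappa) <= e.
  apply: (@le_trans _ _ (q * kappa)); last by rewrite mulrC -ler_pdivlMr.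
  rewrite mulrA ler_wpM2r ?(ltW k0)// /q ler_pM ?lerDl//.
have [d1 d10 H1] := stein_cdf (x - `|x| * kappa) e0.
have [d2 d20 H2] := stein_cdf (x + `|x| * kappa) e0.
pose d' := Num.min d1 d2.
have d'0 : 0 < d' by rewrite lt_min d10.
have [d'1 d'2] : d' <= d1 /\ d' <= d2 by split; rewrite ge_min lexx ?orbT.
pose delta := Num.min (kappa / 2) (Num.min (kappa ^+ 2 * e / 16) (d' ^+ 2 / 8)).
have de0 : 0 < delta by rewrite !lt_min !divr_gt0 ?mulr_gt0 ?exprn_gt0.
have dk : delta <= kappa / 2 by rewrite ge_min lexx.
have dke : delta <= kappa ^+ 2 * e / 16 by rewrite !ge_min lexx orbT.
have dd : delta <= d' ^+ 2 / 8 by rewrite !ge_min lexx !orbT.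
exists delta => // S mu t t' d Omega P X n m H c t0 t'0 sampling prec1 H0 supH est0 ratio.
have sup0 i : (`|H i|%:E <= sup_norm H)%E by apply: ereal_sup_ubound; exists i.
have supE : sup_norm H = (fine (sup_norm H))%:E.
  rewrite fineK// ge0_fin_numE//; apply: le_trans (sup0 0%N).
  by rewrite lee_fin.
have H_le i : `|H i| <= fine (sup_norm H) by rewrite -lee_fin -supE.
have E10 : 0 <= \int[P]_w linear_estimator X n H w.
  by move: est0; rewrite unlock => /fine_ge0.
have d01 : 0 < delta <= 1 by rewrite de0; lra.
have k01 : 0 < kappa < 1 by rewrite k0; lra.
have dke' : 16 * delta / kappa ^+ 2 <= e.
  by rewrite ler_pdivrMr ?exprn_gt0//; lra.
have dd' : 8 * delta <= d' ^+ 2 by lra.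
have [mZ [W [W2 Wd /andP[lo up]]]] := studentized_error_cdf_close t0 t'0 sampling
  prec1 H0 H_le c x supE E10 ratio d01 k01 dk dke' d'0 dd'.
split => //.
have := H1 _ _ P W W2 (stein_bound_le d'1 Wd).
have := H2 _ _ P W W2 (stein_bound_le d'2 Wd).
have xk : 0 <= `|x| * kappa by rewrite mulr_ge0// ltW.
have := @gauss_cdf_shift R x (x - `|x| * kappa) (`|x| * kappa).
rewrite addrAC subrr sub0r normrN (ger0_norm xk) => /(_ (lexx _)).
have := @gauss_cdf_shift R x (x + `|x| * kappa) (`|x| * kappa).
rewrite addrAC subrr add0r (ger0_norm xk) => /(_ (lexx _)).
rewrite -/p !ler_norml => /andP[a1 a2] /andP[b1 b2] /andP[c1 c2] /andP[f1 f2].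
have e3 : eps = e + e + e by rewrite /e; lra.
clear -a1 a2 b1 b2 c1 c2 f1 f2 lo up pk e3.
by apply/andP; split; lra.
Qed.

Theorem theorem27 (R : realType) (S : countType) (mu : probability {fset S} R)
    (r : R -> R) (d : measure_display) (Omega : R -> measurableType d)
    (P : forall t : R, probability (Omega t) R)
    (X : forall t : R, nat -> {RV (P t) >-> {fset S}})
    (n m : forall t : R, {RV (P t) >-> nat})
    (H : R -> nat -> R) (c : R)
    (r_gt0 : forall t : R, 0 < t -> 0 < r t)
    (sampling : forall t : R, 0 < t ->
       poisson_sampling mu t (r t * t) (X t) (n t) (m t))
    (H0 : forall t : R, 0 < t -> H t 0%N = 0)
    (est_ge0 : forall t : R, 0 < t ->
       (0 <= 'E_(P t)[linear_estimator (X t) (n t) (H t)])%E)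
    (mu_prec1 : at_most_one_species mu)
    (H_bounded : \forall t \near +oo, (sup_norm (H t) < +oo)%E)
    (ratio_cvg0 : clt_ratio (X t) (n t) (m t) (H t) @[t --> +oo] --> 0%E) :
  cvg_in_distribution P
    (fun t : R => studentized_error (X t) (n t) (m t) (H t) c)
    (normal_prob 0 1).
Proof.
move=> x _.
suff : P t (studentized_error (X t) (n t) (m t) (H t) c @^-1` `]-oo, x])
    @[t --> +oo] --> (gauss_cdf x)%:E.
  rewrite /gauss_cdf fineK//.
  exact: (fin_num_measure (normal_prob 0 1)).
have /fine_cvgP[ratio_fin ratio0] := ratio_cvg0.
have main eps : 0 < eps -> \forall t \near +oo,
    measurable (studentized_error (X t) (n t) (m t) (H t) c @^-1` `]-oo, x]) /\
    `|fine (P t (studentized_error (X t) (n t) (m t) (H t) c @^-1` `]-oo, x]))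
      - gauss_cdf x| <= eps.
  move=> /(studentized_error_cdf_near x)[delta delta0 near_normal].
  move/cvgrPdist_le : ratio0 => /(_ _ delta0) ratio_le.
  near=> t; have t0 : 0 < t by near: t; exact: nbhs_pinfty_gt.
  apply: near_normal (sampling t t0) mu_prec1 (H0 t t0) _ (est_ge0 t t0) _ => //.
  - by rewrite mulr_gt0// r_gt0.
  - by near: t.
  have rf : clt_ratio (X t) (n t) (m t) (H t) \is a fin_num by near: t.
  rewrite -(fineK rf) lee_fin (le_trans (ler_norm _))// -normrN -sub0r.
  by near: t.
apply/fine_cvgP; split.
  have := main 1 ltr01; apply: filterS => t [mt _].
  exact: fin_num_measure.
apply/cvgrPdist_le => eps /main; apply: filterS => t [_].
by rewrite distrC.
Unshelve. all: by end_near. Qed.
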